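(* Let $H$ be a graph with no isolated vertices. Then the following are equivalent: (1) for every sufficiently large $n$ (i.e. there is $n_0=n_0(H)$ such that for all integers $n>n_0$), $K_n$ is, up to isomorphism, the unique graph with $\binom{n}{2}$ edges and no isolated vertices maximizing $|\operatorname{Emb}(H,G)|$ among all graphs $G$ with $\binom{n}{2}$ edges and no isolated vertices; (2) $\alpha^{\ast}(H)=\frac{v_H}{2}$ and $H$ is not a matching.
   Context: All graphs are finite, simple, without loops, and have no isolated vertices. For a graph $G$, $v_G$ and $e_G$ denote its numbers of vertices and edges. An embedding of $H$ in $G$ is an injective map $\varphi:V(H)\to V(G)$ such that $\varphi(u)\varphi(v)\in E(G)$ for every edge $uv\in E(H)$; $\operatorname{Emb}(H,G)$ is the set of all embeddings of $H$ in $G$. The fractional independence number $\alpha^{\ast}(H)$ is the maximum of $\sum_{v\in V(H)} w_v$ over all weightings $w:V(H)\to[0,1]$ satisfying $w_u+w_v\le 1$ for every edge $uv\in E(H)$. A matching is a graph that is a disjoint union of edges (every connected component is a single edge; a single edge counts as a matching). *)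

(* Defs.v *)
From mathcomp Require Import all_boot all_order all_algebra.
From mathcomp Require Import reals.

Set Implicit Arguments.
Unset Strict Implicit.
Unset Printing Implicit Defensive.

Import Order.TTheory GRing.Theory Num.Theory.

Record sgraph := SGraph {
  vertex :> finType;
  adj : rel vertex;
  adj_sym : symmetric adj;
  adj_irrefl : irreflexive adj
}.

Definition no_isolated (G : sgraph) : Prop :=
  forall u : G, exists v : G, adj u v.

Definition edges (G : sgraph) : {set {set G}} :=
  [set [set p.1; p.2] | p in [set p : G * G | adj p.1 p.2]].

Definition Emb (H G : sgraph) : {set {ffun H -> G}} :=
  [set f : {ffun H -> G} |
    injectiveb f && [forall u, forall v, adj u v ==> adj (f u) (f v)]].

Definition isomorphic (G G' : sgraph) : Prop :=
  exists2 f : G -> G', bijective f & forall u v : G, adj (f u) (f v) = adj u v.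

Section Complete.
Variable n : nat.

Definition complete_adj : rel 'I_n := fun u v => u != v.

Lemma complete_adj_sym : symmetric complete_adj.
Proof. by move=> u v; rewrite /complete_adj eq_sym. Qed.

Lemma complete_adj_irrefl : irreflexive complete_adj.
Proof. by move=> u; rewrite /complete_adj eqxx. Qed.

Definition complete : sgraph := SGraph complete_adj_sym complete_adj_irrefl.
End Complete.

(* The empty graph counts as a matching (the union of no edges). *)
Definition matching (G : sgraph) : Prop :=
  forall x : G, exists u v : G,
    adj u v /\ [set y | connect (@adj G) x y] = [set u; v].

Definition has_size (m : nat) (G : sgraph) : Prop :=
  no_isolated G /\ #|edges G| = m.

Definition maximizer (H : sgraph) (m : nat) (G : sgraph) : Prop :=
  has_size m G /\
  forall G' : sgraph, has_size m G' -> #|Emb H G'| <= #|Emb H G|.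

Definition unique_maximizer (H : sgraph) (m : nat) (G : sgraph) : Prop :=
  maximizer H m G /\
  forall G' : sgraph, maximizer H m G' -> isomorphic G' G.

Local Open Scope ring_scope.

Definition frac_independent (R : realType) (H : sgraph) (w : H -> R) : Prop :=
  (forall v : H, 0 <= w v <= 1) /\
  (forall u v : H, adj u v -> w u + w v <= 1).

(* [a] is the maximum, attained, of the total weight: alpha^*(H) = a. *)
Definition frac_independence_number_is (R : realType) (H : sgraph) (a : R)
  : Prop :=
  (exists2 w : H -> R, frac_independent w & \sum_v w v = a) /\
  (forall w : H -> R, frac_independent w -> \sum_v w v <= a).

(* Main.v *)
Require Import Defs.
From mathcomp Require Import all_boot all_order all_algebra.
From mathcomp Require Import reals.
From mathcomp Require Import zify ring lra.

Import Order.TTheory GRing.Theory Num.Theory.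

Set Implicit Arguments.
Unset Strict Implicit.
Unset Printing Implicit Defensive.

(* A linear programming argument with weights 0, 1/2, 1 and Hall's theorem show
   that [alpha^*(H) = v_H / 2] holds iff Hall's condition [#|S| <= #|N(S)|]
   holds, iff some permutation [p] of [H] satisfies [adj u (p u)] for all [u].

   Necessity.  If Hall's condition fails there is an independent [S] with
   [#|N(S)| < #|S|]; blowing up [S] by [q^2], [N(S)] by [1] and the other vertices
   by [q] gives a graph with [O(q^2)] edges and at least [q^(v_H + 1)] embeddings.
   If [H] is a matching, [Emb H K_n] injects into the embeddings of [H] in the
   matching with ['C(n, 2)] edges.

   Sufficiency.  Write [P = n (n - 1) = 2 e_G], [d] for the degree and
   [rho x = \sum_(z ~ x) d z].  Cutting [H] along the cycles of [p] and applying
   Cauchy-Schwarz to closed walks, the number [R] of homomorphisms with [u |-> x]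
   satisfies [R^2 <= d(x)^2 P^(v_H - 2)], and [R^2 <= d(x)^2 rho(x) P^(v_H - 3)]
   when [u] has degree at least 2, which occurs as [H] is not a matching.  Summing
   the latter, a graph with at least as many embeddings as [K_n] has
   [\sum_x d(x) rho(x)] close to [P^2].  Hence the set [T] of vertices with
   [rho x] close to [P] spans almost all edges, has about [n] vertices, and is
   almost complete.  Removing the vertices outside [T] one at a time loses, per
   edge, slightly less than [v_H n^(v_H - 2)] embeddings; each pair missing in
   [T] costs about [2 e_H n^(v_H - 2)] by Bonferroni.  As [2 e_H > v_H], comparing
   with the slope of [k |-> k^_v_H] in terms of [k (k - 1)] forces [G] to be
   complete. *)

(** * Cauchy-Schwarz and closed walks *)

(** Cauchy-Schwarz without square roots. After expansion the cross terms compare by AM-GM, since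
    [(R i * R j) ^ 2] is at most the product of [a i * b j] and [a j * b i]. *)
Lemma leq_sqr_sum (I : finType) (Q : pred I) (R a b : I -> nat) :
  (forall i, Q i -> R i ^ 2 <= a i * b i) ->
  (\sum_(i | Q i) R i) ^ 2 <= (\sum_(i | Q i) a i) * (\sum_(i | Q i) b i).
Proof.
move=> leR.
have RR i j : Q i -> Q j -> R i * R j * 2 <= a i * b j + a j * b i.
  move=> Qi Qj; rewrite -leq_sqr.
  apply: leq_trans (nat_AGM2 (a i * b j) (a j * b i)).1.
  rewrite expnMn mulnC leq_mul2l /=.
  by rewrite expnMn; apply: leq_trans (leq_mul (leR i Qi) (leR j Qj)) _; lia.
rewrite -(leq_pmul2l (isT : 0 < 2)) -mulnn !big_distrlr /= [X in _ <= X]mul2n.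
rewrite -addnn [X in _ <= _ + X]exchange_big /= -big_split /= mulnC big_distrl.
apply: leq_sum => i Qi; rewrite -big_split /= big_distrl.
by apply: leq_sum => j Qj; rewrite RR.
Qed.

Lemma card_fibers_le (A B : finType) (f : A -> B) (F : {set A}) (D : nat) :
  (forall y, y \in f @: F -> #|[set x in F | f x == y]| <= D) ->
  #|F| <= #|f @: F| * D.
Proof.
move=> fD; rewrite -sum1_card (partition_big_imset f) /= -sum_nat_const.
by apply: leq_sum => y /fD; rewrite sum1dep_card.
Qed.

Section Walks.
Variables (X : finType) (e : rel X).
Hypothesis e_sym : symmetric e.

Definition deg (x : X) : nat := #|[set y | e x y]|.
Definition vol : nat := \sum_x deg x.
Definition rho (x : X) : nat := \sum_(y | e x y) deg y.

Lemma sum_deg (x : X) : \sum_(y | e x y) 1 = deg x.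
Proof. by rewrite sum1dep_card. Qed.

Lemma rho_le_vol (x : X) : rho x <= vol.
Proof. by rewrite /vol (bigID (e x)) leq_addr. Qed.

(* [walks k x y] counts the walks with [k.+1] edges from [x] to [y]. *)
Fixpoint walks (k : nat) (x y : X) : nat :=
  if k is k'.+1 then \sum_(z | e x z) walks k' z y else e x y.

Lemma walksSr (k : nat) (x y : X) :
  walks k.+1 x y = \sum_(z | e z y) walks k x z.
Proof.
elim: k x => [|k IHk] x.
  by rewrite /= big_mkcond [RHS]big_mkcond; apply: eq_bigr => z _; do 2![case: e].
rewrite -[LHS]/(\sum_(z | e x z) walks k.+1 z y).
under eq_bigr do rewrite IHk.
by rewrite exchange_big.
Qed.

(** Induction on the first step: Cauchy-Schwarz costs the factor [deg x], and the degrees of the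
    neighbours of [x] sum to [rho x], at most [vol]. *)
Lemma sum_sqr_walks (k : nat) (x : X) :
  \sum_y walks k x y ^ 2 <= deg x * vol ^ k.
Proof.
elim: k x => [|k IHk] x.
  rewrite expn0 muln1 -sum_deg big_mkcond [X in _ <= X]big_mkcond /=.
  by apply: leq_sum => y _; case: e.
have S y : walks k.+1 x y ^ 2 <= deg x * \sum_(z | e x z) walks k z y ^ 2.
  by rewrite -sum_deg; apply: leq_sqr_sum => z _; rewrite mul1n.
apply: leq_trans (leq_sum _ (fun y _ => S y)) _.
rewrite -big_distrr /= leq_mul2l exchange_big /=.
apply/orP; right; apply: leq_trans (leq_sum _ (fun z _ => IHk z)) _.
by rewrite -big_distrl /= expnS leq_mul2r rho_le_vol orbT.
Qed.

Lemma closed_walks2 (x : X) : walks 1 x x = deg x.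
Proof. by rewrite /= -sum_deg; apply: eq_bigr => y; rewrite e_sym => ->. Qed.

(** Cutting off the first and last of the [k + 3] edges leaves a walk between two neighbours of [x].
    Cauchy-Schwarz over these [deg x ^ 2] pairs and [sum_sqr_walks] yield the factor [rho x]. *)
Lemma sqr_closed_walks (k : nat) (x : X) :
  walks k.+2 x x ^ 2 <= deg x ^ 2 * (rho x * vol ^ k).
Proof.
have -> : walks k.+2 x x =
  \sum_(p : X * X | e x p.1 && e p.2 x) walks k p.1 p.2.
  rewrite -[LHS]/(\sum_(z | e x z) walks k.+1 z x).
  under eq_bigr do rewrite walksSr.
  by rewrite pair_big_dep.
have -> : deg x ^ 2 = \sum_(p : X * X | e x p.1 && e p.2 x) 1.
  rewrite -(pair_big_dep (e x) (fun i j => e j x) (fun _ _ => 1)) /=.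
  rewrite -mulnn -{1}sum_deg big_distrl /=; apply: eq_bigr => y _.
  rewrite mul1n.
  by rewrite -sum_deg; apply: eq_bigl => z; rewrite e_sym.
apply: leq_trans (leq_sqr_sum (a := fun=> 1) (b := fun p => walks k p.1 p.2 ^ 2) _) _.
  by move=> p _; rewrite mul1n.
rewrite leq_mul2l; apply/orP; right.
rewrite -(pair_big_dep (e x) (fun i j => e j x) (fun y z => walks k y z ^ 2)).
rewrite /= big_distrl /=; apply: leq_sum => y _.
apply: leq_trans (sum_sqr_walks k y).
by rewrite [X in _ <= X](bigID (fun z => e z x)) leq_addr.
Qed.

Lemma sqr_closed_walks_vol (k : nat) (x : X) :
  walks k.+1 x x ^ 2 <= deg x ^ 2 * vol ^ k.
Proof.
case: k => [|k]; first by rewrite closed_walks2 expn0 muln1.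
apply: leq_trans (sqr_closed_walks k x) _.
by rewrite leq_mul2l (expnS vol) leq_mul2r rho_le_vol !orbT.
Qed.
End Walks.

(** * Maps along the cycles of a permutation *)

Section Restriction.
Variables (V X : finType) (x0 : X).
Implicit Types (S : {set V}) (f : {ffun V -> X}).

Definition restr S f : {ffun V -> X} := [ffun v => if v \in S then f v else x0].

Lemma card_restr S (F : {set {ffun V -> X}}) :
  #|F| <= #|restr S @: F| * #|restr (~: S) @: F|.
Proof.
pose g f := (restr S f, restr (~: S) f).
have g_inj : injective g.
  move=> f1 f2 [/ffunP e1 /ffunP e2]; apply/ffunP => v.
  by move: (e1 v) (e2 v); rewrite !ffunE inE; case: (v \in S).
rewrite -(card_imset F g_inj) -cardsX; apply/subset_leq_card/subsetP => _ /imsetP[f Ff ->].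
by rewrite in_setX !imset_f.
Qed.
End Restriction.

Section PartialMaps.
Variables (X V : finType) (e : rel X) (p : V -> V) (x0 : X).
Hypotheses (e_sym : symmetric e) (p_inj : injective p).
Hypothesis p_fix : forall u, p u != u.
Implicit Types (S O : {set V}).

Definition stable S := forall v, (p v \in S) = (v \in S).

(* Maps on a [p]-stable set [S] are encoded as total maps equal to [x0] off [S]. *)
Definition pmaps S : {set {ffun V -> X}} :=
  [set f : {ffun V -> X} |
    [forall v, if v \in S then e (f v) (f (p v)) else f v == x0]].

Definition pmaps_at S u x := [set f in pmaps S | f u == x].

Lemma pmapsP S (f : {ffun V -> X}) :
  reflect ((forall v, v \in S -> e (f v) (f (p v))) /\
           (forall v, v \notin S -> f v = x0))
          (f \in pmaps S).
Proof.
rewrite inE; apply: (iffP forallP) => [fS | [fS f0] v].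
  by split=> v vS; move: (fS v); rewrite ?vS ?(negbTE vS) // => /eqP.
by case: ifPn => vS; [apply: fS | rewrite f0].
Qed.

Lemma in_pmaps_at S u x f : (f \in pmaps_at S u x) = (f \in pmaps S) && (f u == x).
Proof. by rewrite inE. Qed.

Lemma restr_pmaps S O f :
  stable O -> f \in pmaps S -> restr x0 O f \in pmaps (S :&: O).
Proof.
move=> stO /pmapsP[fS f0]; apply/pmapsP; split=> v; rewrite inE !ffunE ?stO.
  by case/andP=> vS ->; apply: fS.
by case: (v \in O); rewrite ?andbF // andbT; apply: f0.
Qed.

Lemma stableC S : stable S -> stable (~: S).
Proof. by move=> stS v; rewrite !inE stS. Qed.

Lemma stableI S O : stable S -> stable O -> stable (S :&: O).
Proof. by move=> stS stO v; rewrite !inE stS stO. Qed.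

Definition cyc u : {set V} := [set v in orbit p u].

Lemma mem_cyc u : u \in cyc u.
Proof. by rewrite inE in_orbit. Qed.

Lemma stable_cyc u : stable (cyc u).
Proof.
move=> v; rewrite !inE -!fconnect_orbit.
by rewrite -(same_fconnect1_r p_inj).
Qed.

Lemma card_cyc u : #|cyc u| = order p u.
Proof. by rewrite cardsE -size_orbit; apply/card_uniqP/orbit_uniq. Qed.

Lemma cyc_sub S u : stable S -> u \in S -> cyc u \subset S.
Proof.
move=> stS uS; apply/subsetP => v; rewrite inE -fconnect_orbit => /iter_findex <-.
by elim: (findex _ _ _) => //= n; rewrite stS.
Qed.

Lemma order_gt1 u : 1 < order p u.
Proof.
rewrite ltn_neqAle order_gt0 andbT; apply: contra (p_fix u) => /eqP o1.
by have := iter_order p_inj u; rewrite -o1 /= => ->.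
Qed.

(** Enumerates what [walks k x y] counts; each list omits the starting vertex [x]. *)
Fixpoint walk_seqs (k : nat) (x y : X) : seq (seq X) :=
  if k is k'.+1 then
    [seq z :: s | z <- enum [pred z | e x z], s <- walk_seqs k' z y]
  else nseq (e x y) [:: y].

Lemma size_walk_seqs k x y : size (walk_seqs k x y) = walks e k x y.
Proof.
elim: k x => [|k IHk] x /=; first by rewrite size_nseq.
rewrite size_allpairs_dep sumnE big_map big_enum_cond /=.
by apply: eq_big => [z|z _]; rewrite ?inE ?andbT // IHk.
Qed.

Lemma mem_walk_seqs k x y s :
  size s = k.+1 -> path e x s -> last x s = y -> s \in walk_seqs k x y.
Proof.
elim: k x s => [|k IHk] x [|z s] //= [sz] /andP[xz zs] ly.
  by case: s sz zs ly => //= _ _ <-; rewrite xz mem_seq1.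
by apply/allpairsPdep; exists z, s; split=> //; [rewrite mem_enum inE | apply: IHk].
Qed.

(** Read along the cycle of [u], a map is a closed walk at [x] with [order p u] edges; the
    predecessor appears because [walks k] counts walks with [k.+1] edges. *)
Lemma card_pmaps_cyc u x :
  #|pmaps_at (cyc u) u x| <= walks e (order p u).-1 x x.
Proof.
(* The trajectory starts at [p u] and ends at [u], as the lists omit their starting vertex. *)
pose g (f : {ffun V -> X}) := [seq f v | v <- traject p (p u) (order p u)].
have mem_tr v : (v \in traject p (p u) (order p u)) = (v \in cyc u).
  rewrite inE -!fconnect_orbit (same_fconnect1 p_inj) fconnect_orbit /orbit.
  congr (_ \in traject _ _ _).
  by apply/eq_card => w; rewrite !inE (same_fconnect1 p_inj).
rewrite -size_walk_seqs cardE -(size_map g); apply: uniq_leq_size.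
  rewrite map_inj_in_uniq ?enum_uniq // => f1 f2; rewrite !mem_enum !in_pmaps_at.
  move=> /andP[/pmapsP[_ f10] _] /andP[/pmapsP[_ f20] _] /eq_in_map eg.
  apply/ffunP => v; case: (boolP (v \in cyc u)) => [|vu]; last by rewrite f10 ?f20.
  by rewrite -mem_tr => /eg.
move=> _ /mapP[f + ->]; rewrite mem_enum in_pmaps_at => /andP[/pmapsP[f1 _] /eqP <-].
apply: mem_walk_seqs.
- by rewrite size_map size_traject prednK // order_gt0.
- apply: (homo_path_in (P := mem (cyc u)) (e := frel p)).
  + by move=> v w vu _ /eqP <-; apply: f1.
  + by apply/allP => v; rewrite in_cons mem_tr => /predU1P[->|//]; apply: mem_cyc.
  + exact: fpath_traject.
- by rewrite last_map last_traject iter_order.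
Qed.

Lemma pmaps_at_split S u x :
  stable S -> u \in S ->
  #|pmaps_at S u x| <= #|pmaps_at (cyc u) u x| * #|pmaps (S :\: cyc u)|.
Proof.
move=> stS uS; have stO := @stable_cyc u.
apply: leq_trans (card_restr x0 (cyc u) _) _; apply: leq_mul.
  apply/subset_leq_card/subsetP => _ /imsetP[f + ->].
  rewrite !in_pmaps_at => /andP[fS fu].
  have := restr_pmaps stO fS; rewrite (setIidPr (cyc_sub stS uS)) => ->.
  by rewrite ffunE mem_cyc fu.
apply/subset_leq_card/subsetP => _ /imsetP[f + ->].
by rewrite in_pmaps_at setDE => /andP[fS _]; apply: restr_pmaps (stableC stO) fS.
Qed.

Lemma card_cycD S u : stable S -> u \in S ->
  #|S| = order p u + #|S :\: cyc u|.
Proof.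
by move=> stS uS; rewrite -card_cyc -(cardsID (cyc u) S) (setIidPr (cyc_sub stS uS)).
Qed.

Lemma stable_cycD S u : stable S -> stable (S :\: cyc u).
Proof. by move=> stS; rewrite setDE; apply/stableI/stableC/stable_cyc. Qed.

Lemma sqr_pmaps_at_step S u x (k : nat) : stable S -> u \in S ->
  #|pmaps (S :\: cyc u)| ^ 2 <= vol e ^ k ->
  #|pmaps_at S u x| ^ 2 <= walks e (order p u).-1 x x ^ 2 * vol e ^ k.
Proof.
move=> stS uS leD.
apply: (@leq_trans ((walks e (order p u).-1 x x * #|pmaps (S :\: cyc u)|) ^ 2)).
  rewrite leq_sqr; apply: leq_trans (pmaps_at_split x stS uS) _.
  by rewrite leq_mul2r card_pmaps_cyc orbT.
by rewrite expnMn leq_mul2l leD orbT.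
Qed.

(** The bound for the other cycles is a hypothesis, since this lemma serves within the induction
    that proves it; [sqr_pmaps_at] discharges it. *)
Lemma sqr_pmaps_at_le S u x : stable S -> u \in S ->
  #|pmaps (S :\: cyc u)| ^ 2 <= vol e ^ #|S :\: cyc u| ->
  #|pmaps_at S u x| ^ 2 <= deg e x ^ 2 * vol e ^ (#|S| - 2).
Proof.
move=> stS uS leD; have lt1 := order_gt1 u.
apply: leq_trans (sqr_pmaps_at_step x stS uS leD) _.
have -> : #|S| - 2 = (order p u).-2 + #|S :\: cyc u| by rewrite (card_cycD stS uS); lia.
rewrite expnD mulnA leq_mul //.
by case: (order p u) lt1 => [|[|k]] // _; apply: sqr_closed_walks_vol.
Qed.

Lemma card_pmaps_sum S u : #|pmaps S| = \sum_x #|pmaps_at S u x|.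
Proof.
rewrite -sum1_card (partition_big (fun f : {ffun V -> X} => f u) predT) //=.
by apply: eq_bigr => x _; rewrite sum1dep_card.
Qed.

(** Induction removing the cycle of some [u]. Summing over the image [x] of [u] by Cauchy-Schwarz,
    the two factors [deg e x] each sum to [vol e], which restores the exponent lowered by 2. *)
Lemma sqr_pmaps S : stable S -> #|pmaps S| ^ 2 <= vol e ^ #|S|.
Proof.
have [n] := ubnP #|S|; elim: n S => // n IHn S /ltnSE leSn stS.
have [->|/set0Pn[u uS]] := eqVneq S set0.
  rewrite cards0 -[X in _ <= X]/(1 ^ 2) leq_sqr; apply/card_le1_eqP => f g.
  by move=> /pmapsP[_ f0] /pmapsP[_ g0]; apply/ffunP => v; rewrite f0 ?g0 ?inE.
have lt1 := order_gt1 u; have cD := card_cycD stS uS.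
have IH : #|pmaps (S :\: cyc u)| ^ 2 <= vol e ^ #|S :\: cyc u|.
  by apply: IHn; [lia | apply: stable_cycD].
rewrite (card_pmaps_sum S u).
apply: leq_trans (leq_sqr_sum (a := deg e)
  (b := fun x => deg e x * vol e ^ (#|S| - 2)) _) _ => [x _|].
  by rewrite mulnA mulnn; apply: sqr_pmaps_at_le.
rewrite -big_distrl /= mulnA mulnn -expnD.
by have -> : 2 + (#|S| - 2) = #|S| by lia.
Qed.

Lemma sqr_pmaps_at S u x : stable S -> u \in S ->
  #|pmaps_at S u x| ^ 2 <= deg e x ^ 2 * vol e ^ (#|S| - 2).
Proof.
by move=> stS uS; apply: sqr_pmaps_at_le => //; apply/sqr_pmaps/stable_cycD.
Qed.

Lemma sqr_pmaps_at_rho S u x : stable S -> u \in S -> 2 < order p u ->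
  #|pmaps_at S u x| ^ 2 <= deg e x ^ 2 * (rho e x * vol e ^ (#|S| - 3)).
Proof.
move=> stS uS lt2.
apply: leq_trans (sqr_pmaps_at_step x stS uS (sqr_pmaps (stable_cycD u stS))) _.
have -> : #|S| - 3 = (order p u) - 3 + #|S :\: cyc u| by rewrite (card_cycD stS uS); lia.
rewrite expnD !mulnA leq_mul // -mulnA.
by case: (order p u) lt2 => [|[|[|k]]] // _; rewrite !subSS subn0; apply: sqr_closed_walks.
Qed.

End PartialMaps.

(** * Rooted homomorphism counts *)

Section Homs.
Variables (H : sgraph) (p : H -> H) (X : finType) (e : rel X).
Hypotheses (e_sym : symmetric e) (p_inj : injective p).
Hypothesis p_adj : forall u, adj u (p u).

Definition homs : {set {ffun H -> X}} :=
  [set f : {ffun H -> X} | [forall u, forall v, adj u v ==> e (f u) (f v)]].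

Definition homs_at (u : H) (x : X) := [set f in homs | f u == x].

Lemma homsP (f : {ffun H -> X}) :
  reflect (forall u v, adj u v -> e (f u) (f v)) (f \in homs).
Proof.
rewrite inE; apply: (iffP forallP) => fh u; last by apply/forallP => v; apply/implyP/fh.
by move=> v; move/forallP/(_ v)/implyP: (fh u).
Qed.

Let p_fix u : p u != u.
Proof. by apply/eqP => pu; have := p_adj u; rewrite pu adj_irrefl. Qed.

Let stableT : stable p [set: H].
Proof. by move=> v; rewrite !inE. Qed.

Lemma homs_pmaps x0 : homs \subset pmaps e p x0 setT.
Proof.
apply/subsetP => f /homsP fh; apply/pmapsP; split=> v; last by rewrite inE.
by move=> _; apply: fh.
Qed.

Lemma homs_at_sub u x : homs_at u x \subset pmaps_at e p x setT u x.
Proof.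
apply/subsetP => f; rewrite in_pmaps_at inE => /andP[fh ->].
by rewrite (subsetP (homs_pmaps x)).
Qed.

Lemma sqr_homs_at u x :
  #|homs_at u x| ^ 2 <= deg e x ^ 2 * vol e ^ (#|H| - 2).
Proof.
rewrite -cardsT; apply: leq_trans (sqr_pmaps_at x e_sym p_inj p_fix x stableT (in_setT u)).
by rewrite leq_sqr; apply/subset_leq_card/homs_at_sub.
Qed.

(** The cycle of [u] is just [u, p u], so [w] lies off it, and the edge [uw] forces the image of [w]
    to be a neighbour [z] of [x]. *)
Lemma homs_at_split u w x : p (p u) = u -> adj u w -> w != p u ->
  #|homs_at u x| <=
  #|pmaps_at e p x (cyc p u) u x| *
  \sum_(z | e x z) #|pmaps_at e p x (~: cyc p u) w z|.
Proof.
move=> ppu uw wpu; have stO := stable_cyc p_inj u.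
have w_cyc : w \in ~: cyc p u.
  rewrite !inE -fconnect_orbit; apply/negP => /iter_findex ww.
  have : w \in [:: u; p u].
    rewrite -ww; elim: (findex _ _ _) => [|n]; rewrite ?mem_head //= !inE.
    by case/orP=> /eqP ->; rewrite ?ppu eqxx ?orbT.
  rewrite !inE (negbTE wpu) orbF => /eqP wu.
  by move: uw; rewrite wu adj_irrefl.
apply: leq_trans (card_restr x (cyc p u) _) _; apply: leq_mul.
  apply/subset_leq_card/subsetP => _ /imsetP[f + ->].
  rewrite inE in_pmaps_at => /andP[fh fu].
  have := restr_pmaps stO (subsetP (homs_pmaps x) _ fh); rewrite setTI => ->.
  by rewrite ffunE mem_cyc fu.
rewrite -sum1_card (partition_big (fun f : {ffun H -> X} => f w) (e x)) /=.
  apply: leq_sum => z _; rewrite sum1dep_card; apply/subset_leq_card/subsetP => f.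
  rewrite inE in_pmaps_at => /andP[/imsetP[g + ->] ->]; rewrite inE andbT => /andP[gh _].
  by have := restr_pmaps (stableC stO) (subsetP (homs_pmaps x) _ gh); rewrite setTI.
move=> _ /imsetP[f + ->]; rewrite inE => /andP[/homsP fh /eqP <-].
by rewrite ffunE w_cyc; apply: fh.
Qed.

(** If the cycle of [u] has length at least 3, the factor [rho] comes from its closed walks. On a
    cycle of length 2 it comes from the extra neighbour [w], whose image ranges over the neighbours
    of [x]. *)
Lemma sqr_homs_at_rho u w x : adj u w -> w != p u ->
  #|homs_at u x| ^ 2 <= deg e x ^ 2 * (rho e x * vol e ^ (#|H| - 3)).
Proof.
move=> uw wpu; have [lt2|le2] := ltnP 2 (order p u).
  rewrite -cardsT.
  apply: leq_trans (sqr_pmaps_at_rho x e_sym p_inj p_fix x stableT (in_setT u) lt2).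
  by rewrite leq_sqr; apply/subset_leq_card/homs_at_sub.
have o2 : order p u = 2 by apply/eqP; rewrite eqn_leq le2 order_gt1.
have ppu : p (p u) = u by have := iter_order p_inj u; rewrite o2.
have stO := stable_cyc p_inj u; have stC := stableC stO.
have cC : #|H| = 2 + #|~: cyc p u| by rewrite -o2 -card_cyc cardsC.
have w_cyc : w \in ~: cyc p u.
  rewrite !inE /orbit o2 /= !inE (negbTE wpu) orbF; apply: contraTneq uw => ->.
  by rewrite adj_irrefl.
have gt1 : 1 < #|~: cyc p u|.
  by rewrite (card_cycD stC w_cyc) ltn_addr // order_gt1.
have := homs_at_split x ppu uw wpu; rewrite -leq_sqr expnMn => /leq_trans; apply.
apply: leq_mul.
  have := sqr_pmaps_at x e_sym p_inj p_fix x stO (mem_cyc p u).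
  by rewrite card_cyc o2 muln1.
apply: leq_trans (leq_sqr_sum (a := deg e)
  (b := fun z => deg e z * vol e ^ (#|~: cyc p u| - 2)) _) _ => [z _|].
  by rewrite mulnA mulnn; apply: sqr_pmaps_at.
rewrite -big_distrl /= leq_mul2l; apply/orP; right.
have -> : #|H| - 3 = (#|~: cyc p u| - 2).+1 by lia.
by rewrite expnS leq_mul2r rho_le_vol orbT.
Qed.

Lemma sqr_homs u w : adj u w -> w != p u ->
  #|homs| ^ 2 <= vol e ^ (#|H| - 2) * \sum_x deg e x * rho e x.
Proof.
move=> uw wpu.
have -> : #|homs| = \sum_x #|homs_at u x|.
  rewrite -sum1_card (partition_big (fun f : {ffun H -> X} => f u) predT) //=.
  by apply: eq_bigr => x _; rewrite sum1dep_card.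
have gt2 : 2 < #|H|.
  rewrite -cardsT (cardD1 u) (cardD1 (p u)) (cardD1 w) !inE p_fix wpu andbT.
  by case: eqP uw => // ->; rewrite adj_irrefl.
apply: leq_trans (leq_sqr_sum (a := deg e)
  (b := fun x => deg e x * (rho e x * vol e ^ (#|H| - 3))) _) _ => [x _|].
  by rewrite mulnA mulnn; apply: sqr_homs_at_rho wpu.
under [X in _ * X <= _]eq_bigr do rewrite mulnA.
have -> : #|H| - 2 = (#|H| - 3).+1 by lia.
by rewrite -big_distrl /= -/(vol e) expnS mulnA mulnAC.
Qed.
End Homs.

(** * Hall's theorem *)

Section Hall.
Variables (T U : finType) (u0 : U).
Implicit Types (A S : {set T}) (F : T -> {set U}).

Lemma bigcup_setDr S F (B : {set U}) :
  \bigcup_(x in S) (F x :\: B) = \bigcup_(x in S) F x :\: B.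
Proof.
apply/setP => y; rewrite inE; apply/bigcupP/andP => [[x xS]|[yB /bigcupP[x xS yF]]].
  by rewrite inE => /andP[-> yF]; split=> //; apply/bigcupP; exists x.
by exists x => //; rewrite inE yB.
Qed.

(** Induction on [#|A|]. If a proper nonempty [S] is tight, [S] is matched first and [A :\: S] then
    avoids the neighbours of [S]. Otherwise every such set has slack, so any [a] may take any
    partner [b]. *)
Lemma hall_marriage A F :
  (forall S, S \subset A -> #|S| <= #|\bigcup_(x in S) F x|) ->
  exists2 g : T -> U, {in A &, injective g} & {in A, forall x, g x \in F x}.
Proof.
have [n] := ubnP #|A|; elim: n A F => // n IHn A F /ltnSE leAn hallA.
have [->|/set0Pn[a aA]] := eqVneq A set0.
  by exists (fun=> u0) => x; rewrite inE.
have [/existsP[S /and4P[SA S0 SnA /eqP tight]]|/existsPn loose] := boolP [exists S : {set T},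
    [&& S \subset A, S != set0, S != A & #|\bigcup_(x in S) F x| == #|S|]].
  have ltSA : #|S| < #|A| by apply: proper_card; rewrite properEneq SnA.
  have cD : #|A :\: S| < n.
    apply: leq_trans leAn; rewrite -(cardsID S A) (setIidPr SA).
    by rewrite -[X in X < _]add0n ltn_add2r card_gt0.
  have [|g1 g1_inj g1F] := IHn S F (leq_trans ltSA leAn).
    by move=> Q QS; apply/hallA/(subset_trans QS).
  pose B := \bigcup_(x in S) F x.
  have [|g2 g2_inj g2F] := IHn (A :\: S) (fun x => F x :\: B) cD.
    (* Hall's condition for [S :|: Q], minus the tight equality for [S], gives it for [Q]. *)
    move=> Q QD; rewrite bigcup_setDr -(leq_add2l #|S|).
    have dSQ : [disjoint S & Q].
      rewrite disjoint_sym; apply/pred0P => x; apply/andP => -[/(subsetP QD)].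
      by rewrite inE => /andP[/negP].
    have QA : Q \subset A by apply: subset_trans QD (subsetDl _ _).
    have SQA : S :|: Q \subset A by rewrite subUset SA.
    have := hallA _ SQA; rewrite cardsU (disjoint_setI0 dSQ) cards0 subn0.
    move/leq_trans; apply.
    rewrite bigcup_setU -tight -/B cardsU cardsD (setIC B).
    by have := subset_leq_card (subsetIl (\bigcup_(x in Q) F x) B); lia.
  exists (fun x => if x \in S then g1 x else g2 x) => x.
    move=> y xA yA; case: ifPn => xS; case: ifPn => yS.
    - exact: g1_inj.
    - move=> e12; have : g2 y \in F y :\: B by apply: g2F; rewrite inE yS.
      by rewrite inE -e12 => /andP[/bigcupP[]]; exists x => //; apply: g1F.
    - move=> e12; have : g2 x \in F x :\: B by apply: g2F; rewrite inE xS.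
      by rewrite inE e12 => /andP[/bigcupP[]]; exists y => //; apply: g1F.
    - by apply: g2_inj; rewrite inE ?xS ?yS.
  move=> xA; case: ifPn => xS; first exact: g1F.
  have : g2 x \in F x :\: B by apply: g2F; rewrite inE xS.
  by rewrite inE => /andP[].
have [b bF] : exists b, b \in F a.
  apply/set0Pn; have := hallA [set a]; rewrite sub1set big_set1 cards1 => /(_ aA).
  by rewrite card_gt0.
have [||g g_inj gF] := IHn (A :\ a) (fun x => F x :\ b).
- by move: leAn; rewrite (cardsD1 a) aA.
- move=> Q QA; have [->|Q0] := eqVneq Q set0; first by rewrite cards0.
  rewrite bigcup_setDr; have QA' := subset_trans QA (subsetDl _ _).
  have := loose Q; rewrite QA' Q0 /= negb_and negbK.
  have -> /= : Q == A = false.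
    by apply/eqP => eQA; move: (subsetP QA a); rewrite eQA aA !inE eqxx => /(_ isT).
  have := hallA _ QA'; rewrite leq_eqVlt eq_sym => /orP[->//|lt _].
  by move: lt; rewrite (cardsD1 b); case: (b \in _); lia.
exists (fun x => if x == a then b else g x) => x.
  move=> y xA yA; case: eqP => xa; case: eqP => ya.
  - by rewrite xa ya.
  - move=> bg; have : g y \in F y :\ b by apply: gF; rewrite !inE yA; case: eqP.
    by rewrite -bg !inE eqxx.
  - move=> bg; have : g x \in F x :\ b by apply: gF; rewrite !inE xA; case: eqP.
    by rewrite bg !inE eqxx.
  - by apply: g_inj; rewrite !inE ?xA ?yA; case: eqP.
move=> xA; case: eqP => [->//|xa].
have : g x \in F x :\ b by apply: gF; rewrite !inE xA; case: eqP.
by rewrite inE => /andP[].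
Qed.
End Hall.

Section HallCondition.
Variable H : sgraph.
Implicit Types S : {set H}.

Definition nbh S : {set H} := \bigcup_(u in S) [set v | adj u v].
Definition hall : Prop := forall S, #|S| <= #|nbh S|.

Lemma mem_nbh S u v : u \in S -> adj u v -> v \in nbh S.
Proof. by move=> uS uv; apply/bigcupP; exists u; rewrite // inE. Qed.

Lemma nbhP S v : reflect (exists2 u, u \in S & adj u v) (v \in nbh S).
Proof. by apply: (iffP bigcupP) => -[u uS]; rewrite ?inE => uv; exists u; rewrite ?inE. Qed.

Lemma hall_perm : hall -> exists2 p : H -> H, injective p & forall u, adj u (p u).
Proof.
move=> hallH; have [u0 _|H0] := pickP (@predT H); last first.
  by exists id => u; have := H0 u.
have [|p p_inj pF] := @hall_marriage H H u0 setT (fun u => [set v | adj u v]).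
  by move=> S _; apply: hallH.
exists p => [u v|u]; first by apply: p_inj; rewrite inE.
by have := pF u; rewrite !inE; apply.
Qed.

(* Passing to the vertices of [S] without neighbour in [S] keeps a violation of
   Hall's condition. *)
Lemma not_hall_independent : ~ hall ->
  exists S, [/\ #|nbh S| < #|S| & forall u v, u \in S -> v \in S -> ~~ adj u v].
Proof.
move=> nhall.
have [/existsP[S SN]|/existsPn nS] := boolP [exists S : {set H}, #|nbh S| < #|S|]; last first.
  by case: nhall => S; rewrite leqNgt nS.
exists (S :\: nbh S); split; last first.
  move=> u v; rewrite !inE => /andP[_ uS] /andP[vN _].
  by apply: contra vN; apply: mem_nbh.
(* A vertex of [S] adjacent to one of [S :\: nbh S] would put the latter in [nbh S]. It then remains
   to remove the same intersection from [nbh S] and from [S]. *)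
have sub : nbh (S :\: nbh S) \subset nbh S :\: S.
  apply/subsetP => v /nbhP[u]; rewrite !inE => /andP[uN uS] uv.
  rewrite (mem_nbh uS uv) andbT; apply: contra uN => vS.
  by rewrite (mem_nbh vS) // adj_sym.
apply: leq_ltn_trans (subset_leq_card sub) _.
rewrite -(ltn_add2l #|S :&: nbh S|) cardsID.
by rewrite setIC cardsID.
Qed.
End HallCondition.

(** * Matchings and fractional independence *)

Lemma matching_nbr_uniq (H : sgraph) : matching H ->
  forall x y z : H, adj x y -> adj x z -> y = z.
Proof.
move=> matH x y z xy xz; have [u [v [_ /setP cuv]]] := matH x.
have xuv := cuv x; have yuv := cuv y; have zuv := cuv z.
rewrite !inE connect0 in xuv; rewrite !inE connect1 // in yuv.
rewrite !inE connect1 // in zuv.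
have yx : y != x by apply: contraTneq xy => ->; rewrite adj_irrefl.
have zx : z != x by apply: contraTneq xz => ->; rewrite adj_irrefl.
have {xuv} := esym xuv; case/orP=> /eqP xE; rewrite -xE (negPf yx) (negPf zx) in yuv zuv.
  by rewrite (eqP (esym yuv)) (eqP (esym zuv)).
by rewrite !orbF in yuv zuv; rewrite (eqP (esym yuv)) (eqP (esym zuv)).
Qed.

Lemma nbr_uniq_matching (H : sgraph) : no_isolated H ->
  (forall x y z : H, adj x y -> adj x z -> y = z) -> matching H.
Proof.
move=> isoH uniqH x; have [y xy] := isoH x; exists x, y; split=> //.
apply/setP => z; rewrite !inE; apply/idP/idP; last first.
  by case/orP => /eqP->; [apply: connect0 | apply: connect1].
case/connectP => s xs ->.
have ind a : (a == x) || (a == y) -> path (@adj H) a s ->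
    (last a s == x) || (last a s == y).
  elim: s a {xs} => [|b s IHs] a //= axy /andP[ab]; apply: IHs.
  case/orP: axy => /eqP aE; rewrite aE in ab; first by rewrite (uniqH _ _ _ ab xy) eqxx orbT.
  by rewrite (uniqH y b x) ?eqxx // adj_sym.
by apply: ind; rewrite ?eqxx.
Qed.

Section Fractional.
Variables (R : realType) (H : sgraph).
Local Open Scope ring_scope.

Lemma frac_independence_hall :
  frac_independence_number_is H (#|H|%:R / 2%:R : R) -> hall H.
Proof.
case=> _ maxH S0; rewrite leqNgt; apply/negP => S0N.
have [|S [ltN indS]] := @not_hall_independent H.
  by move/(_ S0); rewrite leqNgt S0N.
(* The weight is 1 on [S], 0 on [nbh S] and 1/2 elsewhere; its total is
   [(#|H| + #|S| - #|nbh S|) / 2]. *)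
pose w v : R := (1 + (v \in S)%:R - (v \in nbh S)%:R) / 2%:R.
have SN v : v \in S -> v \in nbh S = false.
  move=> vS; apply/negP => /nbhP[u uS uv].
  by move: (indS _ _ uS vS); rewrite uv.
have wI : frac_independent w.
  split=> [v|u v uv]; rewrite /w.
    by case: (boolP (v \in S)) => [/SN ->|_]; case: (v \in nbh S) => /=; lra.
  case: (boolP (u \in S)) => [uS|_].
    have vS : v \in S = false by apply/negP => vS; move: (indS _ _ uS vS); rewrite uv.
    by rewrite SN // vS (mem_nbh uS uv) /=; lra.
  case: (boolP (v \in S)) => [vS|_].
    by rewrite (SN v) // (mem_nbh vS) 1?adj_sym //=; lra.
  by case: (u \in nbh S); case: (v \in nbh S) => /=; lra.
have := maxH _ wI; rewrite -mulr_suml !big_split /= sumrN -!natr_sum.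
rewrite -!big_mkcond /= !sum1_card.
have : (#|nbh S|%:R < #|S|%:R :> R) by rewrite ltr_nat.
rewrite sumr_const.
lra.
Qed.

(** Each weight appears twice in the sum of [w u + w (p u)] over all [u], whose terms are at most 1.
    The constant weight 1/2 attains the bound. *)
Lemma hall_frac_independence :
  hall H -> frac_independence_number_is H (#|H|%:R / 2%:R : R).
Proof.
case/hall_perm => p p_inj p_adj; split.
  exists (fun=> 1 / 2%:R); last by rewrite -mulr_suml sumr_const.
  by split=> [v|u v _]; lra.
move=> w [_ wI]; have : \sum_(u : H) (w u + w (p u)) <= \sum_(u : H) 1.
  by apply: ler_sum => u _; apply/wI/p_adj.
have -> : \sum_u (w u + w (p u)) = \sum_u w u + \sum_u w u.
  by rewrite big_split /=; congr (_ + _); rewrite [RHS](reindex_inj p_inj).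
by rewrite sumr_const; lra.
Qed.
End Fractional.

(** * Competitors of the complete graph *)

Lemma embP (H G : sgraph) (f : {ffun H -> G}) :
  reflect (injective f /\ forall u v, adj u v -> adj (f u) (f v)) (f \in Emb H G).
Proof.
rewrite inE; apply: (iffP andP) => [[/injectiveP fI /forallP fh]|[fI fh]].
  by split=> // u v; move/forallP/(_ v)/implyP: (fh u).
by split; [apply/injectiveP | do 2![apply/forallP => ?]; apply/implyP/fh].
Qed.

Lemma vol_arcs (X : finType) (e : rel X) : vol e = #|[set q : X * X | e q.1 q.2]|.
Proof.
rewrite /vol; under eq_bigr do rewrite -sum_deg.
by rewrite pair_big_dep /= sum1dep_card.
Qed.

Lemma handshake (G : sgraph) : vol (@adj G) = (#|edges G|).*2.
Proof.
rewrite vol_arcs -sum1_card (partition_big_imset (fun q => [set q.1; q.2])) /=.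
rewrite -muln2 -sum_nat_const; apply: eq_bigr => _ /imsetP[[x y] + ->].
rewrite inE /= => xy; have neq : x != y by apply: contraTneq xy => ->; rewrite adj_irrefl.
rewrite sum1dep_card -[RHS](_ : #|[set (x, y); (y, x)]| = 2); last first.
  by rewrite cards2 xpair_eqE (negPf neq).
apply: eq_card => -[a b]; rewrite !inE /= !xpair_eqE.
apply/andP/orP => [[ab /eqP/setP E]|[] /andP[/eqP-> /eqP->]].
- have := E a; have := E b; rewrite !inE !eqxx orbT /=.
  move=> /esym/orP[]/eqP eb /esym/orP[]/eqP ea; move: ab; rewrite ea eb ?adj_irrefl //.
    by right; rewrite !eqxx.
  by left; rewrite !eqxx.
- by split.
- by split; [rewrite adj_sym | rewrite setUC].
Qed.

Lemma double_bin2 (n : nat) : ('C(n, 2)).*2 = n * n.-1.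
Proof. by rewrite bin2 -[RHS]odd_double_half oddM; case: n => //= n; rewrite andNb. Qed.

Lemma edges_vol (G : sgraph) (n : nat) :
  #|edges G| = 'C(n, 2) <-> vol (@adj G) = n * n.-1.
Proof.
by rewrite handshake -double_bin2; split=> [->//|/double_inj].
Qed.

Lemma vol_complete (n : nat) : vol (@adj (complete n)) = n * n.-1.
Proof.
rewrite /vol (eq_bigr (fun=> n.-1)) ?sum_nat_const ?card_ord // => x _.
rewrite /deg (_ : [set _ | _] = ~: [set x]) ?cardsC1 ?card_ord //.
by apply/setP => y; rewrite !inE eq_sym.
Qed.

Lemma complete_size (n : nat) : 1 < n -> has_size 'C(n, 2) (complete n).
Proof.
case: n => [|[|n]] // _; split; last exact/edges_vol/vol_complete.
move=> u; exists (if u == ord0 then ord_max else ord0).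
by rewrite /= /complete_adj; case: (u =P ord0) => [->|/eqP].
Qed.

Lemma card_Emb_complete (H : sgraph) (n : nat) : #|Emb H (complete n)| = n ^_ #|H|.
Proof.
rewrite -[in RHS](card_ord n) -card_inj_ffuns; apply: eq_card => f.
rewrite [in RHS]inE; apply/embP/injectiveP => [[]|fI] //; split=> // u v uv.
by apply/eqP => /fI uv'; rewrite uv' adj_irrefl in uv.
Qed.

Section ArcMatching.
Variable n : nat.

Definition arc : finType := {q : 'I_n * 'I_n | q.1 != q.2}.

Definition arc_adj : rel arc := fun q r => (val r) == ((val q).2, (val q).1).

Lemma arc_adj_sym : symmetric arc_adj.
Proof.
move=> [[a b] /= ab] [[c d] /= cd]; rewrite /arc_adj /= !xpair_eqE.
by rewrite (eq_sym c) (eq_sym d) andbC.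
Qed.

Lemma arc_adj_irrefl : irreflexive arc_adj.
Proof. by move=> [[a b] /= ab]; rewrite /arc_adj /= xpair_eqE (negPf ab). Qed.

(* The vertices are the arcs of [K_n], each one joined to its reverse. *)
Definition arc_matching : sgraph := SGraph arc_adj_sym arc_adj_irrefl.

Lemma arc_rev (q : arc) : exists r : arc, val r = ((val q).2, (val q).1).
Proof.
case: q => -[a b] /= ab; have ba : (b, a).1 != (b, a).2 by rewrite /= eq_sym.
by exists (Sub (b, a) ba : arc).
Qed.

Lemma deg_arc_matching (q : arc_matching) : deg (@adj arc_matching) q = 1.
Proof.
have [r rE] := arc_rev q; rewrite -(cards1 r) /deg; apply: eq_card => s.
by rewrite !inE /= /arc_adj -rE.
Qed.

Lemma card_arc : #|{: arc}| = n * n.-1.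
Proof.
rewrite card_sig -(vol_complete n) vol_arcs.
by apply: eq_card => q; rewrite !inE.
Qed.

Lemma arc_matching_size : has_size 'C(n, 2) arc_matching.
Proof.
split=> [q|]; first by have [r rE] := arc_rev q; exists r; rewrite /= /arc_adj rE.
apply/edges_vol; rewrite /vol (eq_bigr (fun=> 1)) => [|q _]; last exact: deg_arc_matching.
by rewrite sum1_card card_arc.
Qed.
End ArcMatching.

(** With [p] sending each vertex to its only neighbour, an embedding [f] lifts to the map taking [u]
    to the arc from [f u] to [f (p u)]; first coordinates recover [f]. *)
Lemma Emb_arc_matching (H : sgraph) (n : nat) : no_isolated H -> matching H ->
  #|Emb H (complete n)| <= #|Emb H (arc_matching n)|.
Proof.
move=> isoH /matching_nbr_uniq uniqH.
have /fin_all_exists[p p_adj] := isoH.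
have ppu u : p (p u) = u by apply: uniqH (p_adj _) _; rewrite adj_sym.
pose B (g : {ffun H -> arc_matching n}) : {ffun H -> complete n} :=
  [ffun u => (val (g u)).1].
apply: leq_trans (leq_imset_card B _); apply/subset_leq_card/subsetP => f /embP[fI _].
have fp u : f u != f (p u).
  by apply/eqP => /fI up; have := p_adj u; rewrite -up adj_irrefl.
apply/imsetP; exists [ffun u => Sub (f u, f (p u)) (fp u) : arc n]; last first.
  by apply/ffunP => u; rewrite !ffunE.
apply/embP; split=> [u v|u v uv]; rewrite !ffunE; first by case=> /fI.
by rewrite /= /arc_adj /= (uniqH _ _ _ uv (p_adj u)) ppu.
Qed.

(** Otherwise the matching on the arcs is a maximizer too, hence isomorphic to [K_n]; but it has
    [n (n - 1)] vertices, more than [n] once [n > 2]. *)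
Lemma unique_maximizer_not_matching (H : sgraph) (n : nat) :
  2 < n -> no_isolated H -> unique_maximizer H 'C(n, 2) (complete n) -> ~ matching H.
Proof.
move=> n3 isoH [[_ maxK] uniqK] matH.
have [|f f_bij _] := uniqK (arc_matching n).
  split=> [|G Gm]; first exact: arc_matching_size.
  exact: leq_trans (maxK G Gm) (Emb_arc_matching n isoH matH).
have := bij_eq_card f_bij; rewrite card_arc card_ord; nia.
Qed.

(** * Padding to a prescribed number of edges *)

Section Padding.
Variables (G : sgraph) (r : nat).

Definition touched : {set G} := [set x | [exists y, adj x y]].

(** Isolated vertices are dropped and [r] disjoint edges are added, the edge [i] joining
    [(i, false)] to [(i, true)]. *)
Definition pad_vertex : finType := ({x in touched} + 'I_r * bool)%type.

Definition pad_adj : rel pad_vertex := fun a b =>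
  match a, b with
  | inl x, inl y => adj (val x) (val y)
  | inr i, inr j => (i.1 == j.1) && (i.2 != j.2)
  | _, _ => false
  end.

Lemma pad_adj_sym : symmetric pad_adj.
Proof.
by move=> [x|[i b]] [y|[j c]] //=; rewrite 1?adj_sym // eq_sym [b == c]eq_sym.
Qed.

Lemma pad_adj_irrefl : irreflexive pad_adj.
Proof. by move=> [x|[i b]] /=; rewrite ?adj_irrefl ?eqxx ?andbF. Qed.

Definition pad : sgraph := SGraph pad_adj_sym pad_adj_irrefl.

Lemma adj_touched (x y : G) : adj x y -> x \in touched.
Proof. by move=> xy; rewrite inE; apply/existsP; exists y. Qed.

Lemma pad_no_isolated : no_isolated pad.
Proof.
move=> [[x xT]|[i b]]; last by exists (inr (i, ~~ b)); rewrite /= eqxx; case: b.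
have := xT; rewrite inE => /existsP[y xy].
have yT : y \in touched by apply: (@adj_touched _ x); rewrite adj_sym.
by exists (inl (exist _ y yT)).
Qed.

Lemma vol_pad : vol (@adj pad) = vol (@adj G) + r.*2.
Proof.
rewrite /vol big_sumType /=; congr (_ + _).
  rewrite [RHS](bigID (mem touched)) /= [X in _ = _ + X]big1 ?addn0; last first.
    move=> x; rewrite inE => /existsPn xN; apply/eqP.
    by rewrite cards_eq0; apply/eqP/setP => y; rewrite !inE (negPf (xN y)).
  rewrite (big_sub touched (deg (@adj G))); apply: eq_bigr => x _.
  rewrite -!sum_deg big_sumType /= big_pred0_eq addn0.
  rewrite -(big_sub_cond touched (fun y => adj (val x) y) (fun=> 1)) /=.
  apply: eq_bigl => y; case: (boolP (adj (val x) y)) => xy; rewrite ?andbF //.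
  by rewrite andbT (@adj_touched _ (val x)) // adj_sym.
rewrite (eq_bigr (fun=> 1)) ?sum1_card ?card_prod ?card_ord ?card_bool ?muln2 //.
move=> [i b] _; rewrite /deg -(cards1 (inr (i, ~~ b) : pad)).
apply: eq_card => -[y|[j c]]; rewrite !inE //= eq_sym.
by rewrite [RHS]xpair_eqE; case: b; case: c.
Qed.

Lemma Emb_pad (H : sgraph) : no_isolated H -> #|Emb H G| <= #|Emb H pad|.
Proof.
move=> isoH; pose some (f : {ffun H -> G}) := [ffun u => Some (f u)].
(* [None] stands for the added vertices, so that forgetting the padding is a total map. *)
pose B (g : {ffun H -> pad}) : {ffun H -> option G} :=
  [ffun u => if g u is inl x then Some (val x) else None].
have some_inj : injective some.
  by move=> f1 f2 /ffunP E; apply/ffunP => u; have := E u; rewrite !ffunE => -[].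
rewrite -(card_imset _ some_inj); apply: leq_trans (leq_imset_card B _).
apply/subset_leq_card/subsetP => _ /imsetP[f /embP[fI fh] ->].
have fT u : f u \in touched.
  by have [v uv] := isoH u; apply/adj_touched/(fh _ _ uv).
apply/imsetP; exists [ffun u => inl (exist _ (f u) (fT u)) : pad]; last first.
  by apply/ffunP => u; rewrite !ffunE.
apply/embP; split=> [u v|u v uv]; rewrite !ffunE; first by case=> /fI.
exact: fh.
Qed.
End Padding.

Lemma exists_has_size (H G : sgraph) (m : nat) :
  no_isolated H -> #|edges G| <= m ->
  exists2 G' : sgraph, has_size m G' & #|Emb H G| <= #|Emb H G'|.
Proof.
move=> isoH lem; exists (pad G (m - #|edges G|)); last exact: Emb_pad.
split; first exact: pad_no_isolated.
by apply: double_inj; rewrite -handshake vol_pad handshake -doubleD subnKC.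
Qed.

(** * Blow-ups *)

Section BlowUp.
Variables (H : sgraph) (Q : nat) (s : H -> nat).
Hypothesis sQ : forall u, s u <= Q.

(** All classes share the type ['I_Q]. In the class of [u] only the first [s u] copies can carry
    edges; the others are isolated and disappear in the padding. *)
Definition blow_adj : rel (H * 'I_Q) := fun a b =>
  [&& adj a.1 b.1, a.2 < s a.1 & b.2 < s b.1].

Lemma blow_adj_sym : symmetric blow_adj.
Proof. by move=> a b; rewrite /blow_adj adj_sym; congr (_ && _); rewrite andbC. Qed.

Lemma blow_adj_irrefl : irreflexive blow_adj.
Proof. by move=> a; rewrite /blow_adj adj_irrefl. Qed.

Definition blow_up : sgraph := SGraph blow_adj_sym blow_adj_irrefl.

Lemma card_below (u : H) : \sum_(i < Q | i < s u) 1 = s u.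
Proof. by rewrite -(big_ord_widen Q (fun=> 1) (sQ u)) sum1_card card_ord. Qed.

Lemma deg_blow_up (u : H) (i : 'I_Q) :
  deg (@adj blow_up) (u, i) = if i < s u then \sum_(v | adj u v) s v else 0.
Proof.
rewrite -sum_deg /= /blow_adj /=; case: ifP => iu; last first.
  by rewrite big1 // => b; rewrite andbF.
rewrite (eq_bigr _ (fun v _ => esym (card_below v))) pair_big_dep.
by apply: eq_bigl => -[v j].
Qed.

Lemma vol_blow_up (k : nat) :
  (forall u v : H, adj u v -> s u * s v <= k) ->
  vol (@adj blow_up) <= vol (@adj H) * k.
Proof.
move=> sk; rewrite /vol big_distrl /=.
rewrite -(pair_bigA _ (fun u i => deg (@adj blow_up) (u, i))) /=.
apply: leq_sum => u _; under eq_bigr do rewrite deg_blow_up.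
rewrite -big_mkcond -sum_deg big_distrl /=.
rewrite -[X in \sum_(i < Q | _) X]mul1n -big_distrl /= card_below big_distrr /=.
by apply: leq_sum => v uv; rewrite mul1n sk.
Qed.

Lemma Emb_blow_up : \prod_u s u <= #|Emb H blow_up|.
Proof.
under eq_bigr => u _ do rewrite -card_below.
rewrite bigA_distr_big_dep /=.
under eq_bigr do rewrite big1_eq.
rewrite sum1_card.
pose g (f : {ffun H -> 'I_Q}) : {ffun H -> blow_up} := [ffun u => (u, f u)].
have g_inj : injective g.
  by move=> f1 f2 /ffunP E; apply/ffunP => u; have := E u; rewrite !ffunE => -[].
rewrite -(card_imset _ g_inj); apply/subset_leq_card/subsetP => _ /imsetP[f /familyP fs ->].
apply/embP; split=> [u v|u v uv]; rewrite !ffunE; first by case.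
by rewrite /= /blow_adj uv /=; apply/andP; split; apply: fs.
Qed.
End BlowUp.

Lemma ffact_leq_expn (n k : nat) : n ^_ k <= n ^ k.
Proof.
by elim: k => // k IHk; rewrite ffactnSr expnSr leq_mul // leq_subr.
Qed.

Lemma unique_maximizer_hall (H : sgraph) (n0 : nat) : no_isolated H ->
  (forall n, n0 < n -> unique_maximizer H 'C(n, 2) (complete n)) -> hall H.
Proof.
move=> isoH maxK S0; rewrite leqNgt; apply/negP => S0N.
have [|S [ltN indS]] := @not_hall_independent H.
  by move/(_ S0); rewrite leqNgt S0N.
(* [n = c q] leaves room for the at most [(c - 1) q^2] ordered adjacent pairs of the blow-up, and
   [q > c ^ #|H|] makes [q ^ #|H|.+1] exceed [n ^ #|H|]. *)
pose c := (vol (@adj H)).+1; pose q := c ^ #|H| + n0.+1; pose n := c * q.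
have q_gt0 : 0 < q by rewrite /q addnS.
(* The exponent is 2 on [S], 0 on [N] and 1 elsewhere. Along an edge the exponents add up to at most
   2, since neighbours of [S] lie in [N]; in total they give [#|H| + #|S| - #|N|], more than
   [#|H|]. *)
pose N := nbh S; pose k v := 1 + (v \in S) - (v \in N).
have k2 v : k v <= 2 by rewrite /k; case: (v \in S); case: (v \in N).
have sQ v : q ^ k v <= q ^ 2 by rewrite leq_pexp2l.
have kS u v : adj u v -> k u + k v <= 2.
  move=> uv; rewrite /k; case: (boolP (u \in S)) => uS; case: (boolP (v \in S)) => vS.
  - by case/negP: (indS _ _ uS vS).
  - by rewrite (mem_nbh uS uv); case: (u \in N).
  - by rewrite (mem_nbh vS) 1?adj_sym //; case: (v \in N).
  - by case: (u \in N); case: (v \in N).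
have volB : vol (@adj (blow_up (q ^ 2) (fun v => q ^ k v))) <= n * n.-1.
  apply: leq_trans (vol_blow_up sQ (k := q ^ 2) _) _.
    by move=> u v uv; rewrite -expnD leq_pexp2l ?kS.
  rewrite /n /c; move: (vol _) => w; nia.
have edB : #|edges (blow_up (q ^ 2) (fun v => q ^ k v))| <= 'C(n, 2).
  by rewrite -leq_double -handshake double_bin2.
have [G Gm leG] := exists_has_size isoH edB.
have n0n : n0 < n by rewrite /n /q; nia.
have [[_ maxKn] _] := maxK n n0n; have {maxKn} := maxKn G Gm.
rewrite card_Emb_complete leqNgt => /negP; apply.
apply: leq_trans leG; apply: leq_trans (Emb_blow_up sQ).
apply: (@leq_ltn_trans (n ^ #|H|)); first exact: ffact_leq_expn.
rewrite -expn_sum; apply: (@leq_trans (q ^ #|H|.+1)).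
  rewrite expnMn expnS ltn_pmul2r ?expn_gt0 ?q_gt0 //; rewrite /q; lia.
rewrite leq_pexp2l //.
have : \sum_v k v + #|N| = #|H| + #|S|.
  rewrite -!sum1_card [\sum_(_ in N) 1]big_mkcond [\sum_(_ in S) 1]big_mkcond.
  rewrite -!big_split /=; apply: eq_bigr => v _; rewrite /k.
  by case: (v \in S); case: (v \in N).
by rewrite -/N in ltN; lia.
Qed.

(** * The almost complete core *)

Section Induced.
Variables (X : finType) (e : rel X).
Hypothesis e_sym : symmetric e.
Implicit Types (U : {set X}) (x y : X).

(** Vertices outside [U] stay as isolated points, so that all induced subgraphs live on one type. *)
Definition rel_in U : rel X := fun x y => [&& e x y, x \in U & y \in U].

Lemma rel_in_sym U : symmetric (rel_in U).
Proof. by move=> x y; rewrite /rel_in e_sym; congr (_ && _); rewrite andbC. Qed.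

Lemma deg_rel_in U x : deg (rel_in U) x <= deg e x.
Proof. by apply/subset_leq_card/subsetP => y; rewrite !inE => /and3P[]. Qed.

Lemma vol_rel_in U : vol (rel_in U) <= vol e.
Proof. by apply: leq_sum => x _; apply: deg_rel_in. Qed.

Lemma rho_rel_in U x : rho (rel_in U) x <= rho e x.
Proof.
rewrite /rho big_mkcond [X in _ <= X]big_mkcond; apply: leq_sum => y _ /=.
by rewrite {1}/rel_in; case: (e x y) => //=; case: ifP => // _; apply: deg_rel_in.
Qed.

Lemma vol_rel_inD1 U x : irreflexive e -> x \in U ->
  vol (rel_in U) = vol (rel_in (U :\ x)) + (deg (rel_in U) x).*2.
Proof.
move=> e_irr xU; have degD y : y != x ->
    deg (rel_in U) y = deg (rel_in (U :\ x)) y + rel_in U x y.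
  move=> yx; rewrite /deg (cardsD1 x) inE addnC rel_in_sym; congr (_ + _).
  apply: eq_card => z; rewrite !inE /rel_in !inE yx.
  by case: (z != x); rewrite //= ?andbF.
have degx : deg (rel_in (U :\ x)) x = 0.
  by apply/eqP; rewrite cards_eq0; apply/eqP/setP => z; rewrite !inE /rel_in !inE eqxx andbF.
rewrite /vol (bigD1 x) //= [in RHS](bigD1 x) //= degx add0n.
rewrite (eq_bigr _ degD) big_split /= -addnn addnC -addnA; congr (_ + _); rewrite addnC; congr (_ + _).
rewrite -sum_deg big_mkcond [RHS]big_mkcond; apply: eq_bigr => y _.
have [->|yx] /= := eqVneq y x; first by rewrite /rel_in e_irr.
by case: (rel_in U x y).
Qed.

(** An arc not inside [U] starts or ends outside [U], and by symmetry there are equally many of both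
    kinds. *)
Lemma vol_le_rel_in U : vol e <= vol (rel_in U) + (\sum_(x in ~: U) deg e x).*2.
Proof.
have E : \sum_x deg e x = \sum_x \sum_y (e x y : nat).
  by apply: eq_bigr => x _; rewrite -sum_deg big_mkcond; apply: eq_bigr => y _; case: e.
have E' : \sum_x deg (rel_in U) x = \sum_x \sum_y (rel_in U x y : nat).
  apply: eq_bigr => x _; rewrite -sum_deg big_mkcond; apply: eq_bigr => y _.
  by case: rel_in.
have O : \sum_(x in ~: U) deg e x = \sum_x \sum_y ((e x y && (x \notin U)) : nat).
  rewrite big_mkcond; apply: eq_bigr => x _; rewrite inE; case: (x \in U) => /=.
    by rewrite big1 // => y _; rewrite andbF.
  rewrite -sum_deg big_mkcond; apply: eq_bigr => y _; by rewrite andbT; case: e.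
have O' : \sum_(x in ~: U) deg e x = \sum_x \sum_y ((e x y && (y \notin U)) : nat).
  by rewrite O exchange_big; do 2![apply: eq_bigr => ? _]; rewrite e_sym.
rewrite /vol E E' -addnn {1}O O' -!big_split /=; apply: leq_sum => x _.
rewrite -!big_split /=; apply: leq_sum => y _; rewrite /rel_in.
by case: e; case: (x \in U); case: (y \in U).
Qed.

Lemma vol_rel_in_sqr U : vol (rel_in U) <= #|U| ^ 2.
Proof.
rewrite vol_arcs -mulnn -cardsX; apply/subset_leq_card/subsetP => -[x y].
by rewrite in_setX inE => /and3P[_ -> ->].
Qed.

(* The vertices which see almost all of the degree measure. *)
Definition core (M : nat) : {set X} := [set x | M.-1 ^ 2 * vol e <= M ^ 2 * rho e x].

Section Core.
Variables M Q : nat.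
Let P := vol e.
Let T := core M.
Hypotheses (M_ge : 18 <= M) (Q_ge : M ^ 2 <= Q) (P_gt0 : 0 < P).
(** The stability input: the sum is at least [(1 - 1/Q) P^2], where [P^2] is the trivial upper
    bound. [hom_bound_numeric] provides it. *)
Hypothesis h4 : Q * P ^ 2 <= Q * (\sum_x deg e x * rho e x) + P ^ 2.

(** Outside [T], [rho x] is at most [(1 - 1/M) P], so each such vertex costs at least
    [deg x * P / M] in the sum of [h4], whose total deficit is at most [P^2 / Q]. *)
Lemma deg_out_core : Q * (\sum_(x in ~: T) deg e x) <= M * P.
Proof.
pose h := \sum_x deg e x * rho e x; pose D := \sum_(x in ~: T) deg e x.
have : D * P + M * h <= M * (P * P).
  rewrite /D big_mkcond /h big_distrl big_distrr -big_split /=.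
  rewrite [X in _ <= M * (X * _)](erefl : P = \sum_x deg e x) big_distrl big_distrr /=; apply: leq_sum => x _.
  have := rho_le_vol e x; rewrite -/P => rP.
  rewrite !inE -ltnNge; case: ifP => xT; last by rewrite leq_mul2l leq_mul2l rP !orbT.
  rewrite mulnCA -mulnDr [M * (_ * _)]mulnCA leq_mul2l; apply/orP; right.
  move: xT M_ge; rewrite -/P; case: M => // m /=; move: (rho e x) => r; nia.
rewrite -/D; move: h4 P_gt0; rewrite -/h; move: D h P => D' h' P' hQ P0 DM.
rewrite -(leq_pmul2r P0); nia.
Qed.

Lemma core_rho x : x \in T -> M * P <= M * rho e x + 2 * P.
Proof.
rewrite inE -/P; have := rho_le_vol e x; rewrite -/P.
by move: M_ge; case: M => // m; rewrite /=; move: (rho e x) P => r P'; nia.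
Qed.

Lemma core_vol : Q * P <= Q * vol (rel_in T) + 2 * M * P.
Proof. by have := vol_le_rel_in T; have := deg_out_core; rewrite -/P; nia. Qed.

Lemma core_card_ge : Q * P <= Q * #|T| ^ 2 + 2 * M * P.
Proof.
apply: leq_trans core_vol _; rewrite leq_add2r leq_mul2l.
by rewrite vol_rel_in_sqr orbT.
Qed.

Lemma core_not_nbr x : x \in T ->
  M * (\sum_(z | ~~ e x z) deg e z) <= 2 * P.
Proof.
move=> /core_rho; have : P = rho e x + \sum_(z | ~~ e x z) deg e z.
  by rewrite /P /vol (bigID (e x)).
by move: (\sum_(z | _) _) (rho e x) => a b; nia.
Qed.

(** Outside the set [S] of neighbours of [x] in [T] lies degree at most [3P/M]: [P/M] outside [T]
    and [2P/M] on non-neighbours. So [S] spans at least [P - 6P/M] arcs, but at most [deg x ^ 2]. *)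
Lemma core_min_deg x : x \in T -> (forall y, y \in T -> deg e x <= deg e y) ->
  M * P <= M * deg e x ^ 2 + 6 * P.
Proof.
move=> xT minx; pose S := T :&: [set y | e x y].
have cS : #|S| <= deg e x by apply/subset_leq_card/subsetIr.
have outS : \sum_(z in ~: S) deg e z <=
    \sum_(z in ~: T) deg e z + \sum_(z | ~~ e x z) deg e z.
  rewrite big_mkcond [in X in _ <= X]big_mkcond [in X in _ <= _ + X]big_mkcond.
  rewrite -big_split /=; apply: leq_sum => z _; rewrite !inE.
  by case: (M.-1 ^ 2 * _ <= _); case: (e x z) => //=; rewrite ?leq_addr ?leq_addl.
have := vol_le_rel_in S; have := vol_rel_in_sqr S; have := deg_out_core.
have := core_not_nbr xT; rewrite -/P.
have : #|S| ^ 2 <= deg e x ^ 2 by rewrite leq_sqr.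
move: outS; set a := \sum_(z in ~: S) _; set b := \sum_(z in ~: T) _.
set c := \sum_(z | _) _ => abc; set vS := vol (rel_in S).
move=> sd Mc Qb vs PvS.
have Mb : M * b <= P.
  have M0 : 0 < M by lia.
  by rewrite -(leq_pmul2l M0); apply: leq_trans Qb; rewrite mulnA mulnn leq_mul2r Q_ge orbT.
have : M * (b + c) <= 3 * P by lia.
move: vs PvS sd abc; nia.
Qed.

Lemma core_deg_le (A : {set X}) (d : nat) :
  (forall y, y \in A -> d <= deg e y) -> #|A| * d <= \sum_(y in A) deg e y.
Proof. by move=> dA; rewrite -sum_nat_const; apply: leq_sum. Qed.

Lemma core_min : T != set0 ->
  exists2 d, (forall y, y \in T -> d <= deg e y) & M * P <= M * d ^ 2 + 6 * P.
Proof.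
case/set0Pn => x0 x0T; case: (arg_minnP (deg e) x0T) => x xT minx.
by exists (deg e x) => [y yT|]; [exact: minx | apply: core_min_deg xT _].
Qed.

(** The bound [d] of [core_min] satisfies [#|T| d <= P] and [d^2 >= (1 - 6/M) P]; square the former
    and cancel [P]. *)
Lemma core_card_le : M * #|T| ^ 2 <= M * P + 6 * #|T| ^ 2.
Proof.
have [->|/core_min[d dT Md]] := eqVneq T set0; first by rewrite cards0 exp0n // muln0.
have kd : #|T| * d <= P.
  apply: leq_trans (core_deg_le dT) _.
  by rewrite /P /vol [X in _ <= X](bigID (mem T)) leq_addr.
have := leq_mul kd kd; rewrite -(leq_pmul2r P_gt0) => kkd.
have := leq_mul (leqnn (#|T| ^ 2)) Md; move: kkd P_gt0; clear.
by move: #|T| P => k P'; nia.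
Qed.

(** The missing vertices are non-neighbours of [x], of total degree at most [2P/M], and each has
    degree at least nearly the square root of [P], which is close to [#|T|]. Squaring avoids
    roots. *)
Lemma core_miss x : x \in T -> M * #|T :\: [set y | e x y]| <= 3 * #|T|.
Proof.
move=> xT; have /core_min[d dT Md] : T != set0 by apply/set0Pn; exists x.
set A := T :\: _.
have Ad : #|A| * d <= \sum_(z | ~~ e x z) deg e z.
  apply: leq_trans (core_deg_le (A := A) (d := d) _) _.
    by move=> y; rewrite inE => /andP[_ /dT].
  rewrite big_mkcond [X in _ <= X]big_mkcond; apply: leq_sum => y _.
  by rewrite !inE; case: (e x y) => //=; case: ifP.
have MAd : M * #|A| * d <= 2 * P.
  by apply: leq_trans (core_not_nbr xT); rewrite -mulnA leq_mul2l Ad orbT.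
have Mk : M * P <= M * #|T| ^ 2 + 2 * P.
  have := core_card_ge; move: Q_ge M_ge; clear; move: (#|T| ^ 2) P => k2 P'.
  move=> MQ M18 QP; have [|lt] := leqP P' k2; first by nia.
  have M0 : 0 < M by lia.
  rewrite -(leq_pmul2l M0); nia.
rewrite -leq_sqr; move: MAd Mk Md M_ge P_gt0; clear.
move: (M * #|A|) (#|T|) P => a k P' ad Mk Md M18 P0.
have ad2 : a ^ 2 * d ^ 2 <= 4 * P' ^ 2 by move: ad; rewrite -leq_sqr; lia.
have aP : a ^ 2 * (M - 6) <= 4 * M * P'.
  rewrite -(leq_pmul2r P0).
  apply: (@leq_trans (a ^ 2 * (M * d ^ 2))); first by rewrite -mulnA leq_mul2l; lia.
  by nia.
have kP : P' * (M - 2) <= M * k ^ 2 by lia.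
have M6 : 0 < (M - 6) * (M - 2) by rewrite muln_gt0; lia.
rewrite -(leq_pmul2r M6) mulnA; apply: (@leq_trans (4 * M * P' * (M - 2))).
  by rewrite leq_mul2r aP orbT.
apply: (@leq_trans (4 * M * (M * k ^ 2))); first by rewrite -!mulnA !leq_mul2l kP !orbT.
(* The constant 2 grows to 3 to absorb the factors [1 - 6/M] and [1 - 2/M]; [M >= 18] suffices. *)
have : 4 * M * M <= 9 * ((M - 6) * (M - 2)) by nia.
nia.
Qed.
End Core.
End Induced.

(** * Embeddings leaving the core *)

Lemma leq_expn2 (m n k : nat) : m <= n -> m ^ k <= n ^ k.
Proof. by case: k => // k; rewrite leq_exp2r. Qed.

Lemma leq_card_bigcup (I T : finType) (F : I -> {set T}) :
  #|\bigcup_i F i| <= \sum_i #|F i|.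
Proof.
elim/big_rec2: _ => [|i k A _ leA]; first by rewrite cards0.
by rewrite cardsU; apply: leq_trans (leq_subr _ _) _; rewrite leq_add2l.
Qed.

Section Removal.
Variables (H G : sgraph) (p : H -> H) (a b : H) (n M : nat).
Hypotheses (p_inj : injective p) (p_adj : forall u, adj u (p u)).
Hypotheses (ab : adj a b) (bpa : b != p a).
Hypotheses (M_gt0 : 0 < M) (vol_n : vol (@adj G) <= n ^ 2).

Let v := #|H|.

Definition emb_in (U : {set G}) := [set f in Emb H G | [forall u, f u \in U]].

Lemma emb_inP (U : {set G}) (f : {ffun H -> G}) :
  reflect (f \in Emb H G /\ forall u, f u \in U) (f \in emb_in U).
Proof.
have -> : (f \in emb_in U) = (f \in Emb H G) && [forall u, f u \in U] by rewrite inE.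
by apply: (iffP andP) => -[fE /forallP].
Qed.

Lemma emb_in_homs (U : {set G}) : emb_in U \subset homs H (rel_in (@adj G) U).
Proof.
apply/subsetP => f /emb_inP[/embP[_ fh] fU]; apply/homsP => u w uw.
by rewrite /rel_in fh // !fU.
Qed.

Lemma gt2_card : 2 < v.
Proof.
rewrite /v -cardsT (cardD1 a) (cardD1 (p a)) (cardD1 b) !inE bpa andbT.
have -> : p a != a by apply: contraTneq (p_adj a) => ->; rewrite adj_irrefl.
by case: eqP ab => // ->; rewrite adj_irrefl.
Qed.

Lemma homs_at_in_le (U : {set G}) (u : H) (x : G) :
  #|homs_at (rel_in (@adj G) U) u x| <= deg (rel_in (@adj G) U) x * n ^ (v - 2).
Proof.
rewrite -leq_sqr expnMn.
apply: leq_trans (sqr_homs_at (rel_in_sym (@adj_sym G) U) p_inj p_adj u x) _.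
rewrite leq_mul2l -expnM mulnC expnM; apply/orP; right.
by apply: leq_expn2; apply: leq_trans (vol_rel_in _ _) vol_n.
Qed.

(** As [x] is outside the core of [G], [rho x] is at most [(1 - 1/M)^2 n^2] in [G] and in its
    induced subgraphs. Since [a] has the two neighbours [b] and [p a], its rooted count saves a
    factor [1 - 1/M]. *)
Lemma homs_at_in_core_le (U : {set G}) (x : G) :
  x \notin core (@adj G) M ->
  M * #|homs_at (rel_in (@adj G) U) a x| <=
  M.-1 * (deg (rel_in (@adj G) U) x * n ^ (v - 2)).
Proof.
rewrite inE -ltnNge => /ltnW xM; rewrite -leq_sqr !expnMn.
have := sqr_homs_at_rho (rel_in_sym (@adj_sym G) U) p_inj p_adj x ab bpa.
set d := deg _ x; set r := rho _ x; set w := vol _; set R := #|_|; rewrite -/v => le1.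
have rM : M ^ 2 * r <= M.-1 ^ 2 * n ^ 2.
  apply: leq_trans (_ : _ <= M ^ 2 * rho (@adj G) x) _; first by rewrite leq_mul2l rho_rel_in orbT.
  by apply: leq_trans xM _; rewrite leq_mul2l vol_n orbT.
have wn : w <= n ^ 2 by apply: leq_trans (vol_rel_in _ _) vol_n.
have wn' : w ^ (v - 3) <= (n ^ 2) ^ (v - 3).
  exact: leq_expn2.
have -> : (n ^ (v - 2)) ^ 2 = n ^ 2 * (n ^ 2) ^ (v - 3).
  rewrite -expnS -!expnM mulnC; congr (_ ^ (_ * _)); have := gt2_card; lia.
have := leq_mul (leqnn (M ^ 2)) le1.
have := leq_mul (leqnn (d ^ 2)) (leq_mul rM wn').
move: (n ^ 2) (M ^ 2) (M.-1 ^ 2) (d ^ 2) (R ^ 2) (w ^ _); clear.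
move=> n2 M2 M12 d2 R2 ws; move: (n2 ^ _) => ns h1 h2; apply: leq_trans h2 _.
by apply: leq_trans (leq_trans _ h1) _; apply/eq_leq; ring.
Qed.

(** The lost embeddings send some [u] to [x]. Each of the [v] choices of [u] costs at most
    [deg x * n ^ (v - 2)], and the choice [a] only [1 - 1/M] times that. *)
Lemma card_emb_inD1 (U : {set G}) (x : G) : x \in U -> x \notin core (@adj G) M ->
  M * #|emb_in U| <= M * #|emb_in (U :\ x)| +
    (v * M).-1 * (deg (rel_in (@adj G) U) x * n ^ (v - 2)).
Proof.
move=> xU xN; set K := deg _ _ * _.
have sub : emb_in U \subset
    emb_in (U :\ x) :|: \bigcup_(u : H) homs_at (rel_in (@adj G) U) u x.
  apply/subsetP => f fU; have /emb_inP[fE fU'] := fU; rewrite inE.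
  have [/existsP[u /eqP fu]|/existsPn nx] := boolP [exists u, f u == x].
    apply/orP; right; apply/bigcupP; exists u => //.
    by rewrite inE (subsetP (emb_in_homs U)) //= fu.
  by apply/orP; left; apply/emb_inP; split=> // u; rewrite !inE nx fU'.
have le1 : #|emb_in U| <= #|emb_in (U :\ x)| +
    \sum_(u : H) #|homs_at (rel_in (@adj G) U) u x|.
  apply: leq_trans (subset_leq_card sub) _.
  rewrite cardsU; apply: leq_trans (leq_subr _ _) _; rewrite leq_add2l.
  by apply: leq_card_bigcup.
have le2 : M * \sum_(u : H) #|homs_at (rel_in (@adj G) U) u x| <= (v * M).-1 * K.
  rewrite (bigD1 a) //= mulnDr.
  have sumC : \sum_(u : H | u != a) K = v.-1 * K by rewrite sum_nat_const cardC1.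
  have := homs_at_in_core_le U xN; rewrite -/K.
  have : \sum_(u : H | u != a) #|homs_at (rel_in (@adj G) U) u x| <= v.-1 * K.
    by rewrite -sumC; apply: leq_sum => u _; apply: homs_at_in_le.
  move=> h1 h2; apply: leq_trans (leq_add h2 (leq_mul (leqnn M) h1)) _.
  rewrite mulnA -mulnDl leq_mul2r; apply/orP; right.
  by have := gt2_card; move: M_gt0; move: v M => v' M'; nia.
by apply: leq_trans (leq_mul (leqnn M) le1) _; rewrite mulnDr leq_add2l.
Qed.

(** Vertices outside the core are deleted one by one. A deletion takes twice the degree from the
    volume, whence [M.*2] in place of [M]; the core stays that of [G] throughout. *)
Lemma card_emb_in_core (U : {set G}) : core (@adj G) M \subset U ->
  M.*2 * #|emb_in U| +
    (v * M).-1 * n ^ (v - 2) * vol (rel_in (@adj G) (core (@adj G) M)) <=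
  M.*2 * #|emb_in (core (@adj G) M)| +
    (v * M).-1 * n ^ (v - 2) * vol (rel_in (@adj G) U).
Proof.
set T := core _ _; have [k] := ubnP #|U|; elim: k U => // k IHk U /ltnSE leUk TU.
have [UT|/subsetPn[x xU xT]] := boolP (U \subset T).
  by have -> : U = T by apply/eqP; rewrite eqEsubset UT.
have TD : T \subset U :\ x by rewrite subsetD1 TU.
have := IHk (U :\ x); rewrite (cardsD1 x U) xU in leUk; move/(_ leUk TD).
have := card_emb_inD1 xU xT.
rewrite (vol_rel_inD1 (@adj_sym G) (@adj_irrefl G) xU).
move: #|_| #|_| #|_| (vol _) (vol _) (deg _ _) (n ^ _) (v * M).-1.
by move=> e1 e2 e3 v1 v2 d nn c; nia.
Qed.
End Removal.

(** * Embeddings into the core *)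

Section Orientation.
Variable H : sgraph.

(** One orientation per edge, chosen by rank, so that the cardinality is [e_H]. *)
Definition oriented : {set H * H} :=
  [set q | adj q.1 q.2 && (enum_rank q.1 < enum_rank q.2)].

Lemma vol_oriented : vol (@adj H) = (#|oriented|).*2.
Proof.
pose swap (q : H * H) := (q.2, q.1).
have swapK : involutive swap by case.
rewrite vol_arcs -addnn -{2}(card_imset oriented (inv_inj swapK)).
rewrite -cardsUI [X in _ + X]eq_card0 ?addn0 => [|[x y]].
  apply: eq_card => -[x y]; rewrite !inE /=.
  have -> : ((x, y) \in swap @: oriented) = ((y, x) \in oriented).
    by rewrite -[(x, y)]/(swap (y, x)) mem_imset //; apply: inv_inj.
  rewrite !inE /= (adj_sym y); case: (boolP (adj x y)) => //= xy.
  case: ltngtP => // /val_inj/enum_rank_inj xE.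
  by rewrite xE adj_irrefl in xy.
have -> : ((x, y) \in oriented :&: swap @: oriented) =
    ((x, y) \in oriented) && ((y, x) \in oriented).
  by rewrite inE -[X in X \in swap @: _]/(swap (y, x)) mem_imset //; apply: inv_inj.
by rewrite !inE /=; case: ltngtP; rewrite ?andbF.
Qed.

(** All degrees are at least 1 and that of [a] is at least 2. This is [2 e_H > v_H], on which the
    final comparison rests. *)
Lemma vol_gt_card (a b c : H) : no_isolated H ->
  adj a b -> adj a c -> b != c -> #|H| < vol (@adj H).
Proof.
move=> isoH ab ac bc; rewrite /vol (bigD1 a) //= -sum1_card (bigD1 a) //=.
rewrite -[X in X <= _]addSn leq_add //.
  by apply: leq_trans (subset_leq_card (_ : [set b; c] \subset _)); rewrite ?cards2 ?bc //;
     apply/subsetP => z; rewrite !inE => /orP[]/eqP->.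
apply: leq_sum => u _; have [w uw] := isoH u.
by rewrite card_gt0; apply/set0Pn; exists w; rewrite inE.
Qed.
End Orientation.

(** * Injections and missing pairs *)

Section Missing.
Variables (H G : sgraph) (T : {set G}) (D : nat).
Hypothesis D_miss : forall x, x \in T -> #|T :\: [set y | adj x y]| <= D.

Let v := #|H|.
Let k := #|T|.

Definition inj_in : {set {ffun H -> G}} :=
  [set f : {ffun H -> G} in ffun_on (mem T) | injectiveb f].

Lemma inj_inP (f : {ffun H -> G}) :
  reflect ((forall u, f u \in T) /\ injective f) (f \in inj_in).
Proof.
rewrite inE; apply: (iffP andP) => -[].
  by move=> /ffun_onP fT /injectiveP fI.
by move=> fT fI; split; [apply/ffun_onP | apply/injectiveP].
Qed.

Lemma card_inj_in : #|inj_in| = k ^_ v.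
Proof. exact: card_inj_ffuns_on. Qed.

Definition missing : {set G * G} :=
  [set r | [&& r.1 \in T, r.2 \in T, r.1 != r.2 & ~~ adj r.1 r.2]].

Lemma card_missing : vol (rel_in (@adj G) T) + #|missing| = k * k.-1.
Proof.
have -> : k * k.-1 = #|[set r : G * G | [&& r.1 \in T, r.2 \in T & r.1 != r.2]]|.
  rewrite -[LHS](_ : \sum_(x in T) #|T :\ x| = _); last first.
    rewrite -sum_nat_const; apply: eq_bigr => x xT.
    by rewrite /k (cardsD1 x T) xT.
  under eq_bigr do rewrite -sum1_card.
  rewrite pair_big_dep /= sum1dep_card; apply: eq_card => -[x y].
  by rewrite !inE /= [y == x]eq_sym; case: (x \in T); case: (y \in T); rewrite /= ?andbT ?andbF.
rewrite vol_arcs -cardsUI [X in _ + X]eq_card0 ?addn0 => [|[x y]]; last first.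
  by rewrite !inE /rel_in /=; case: (adj x y); rewrite //= !andbF.
apply: eq_card => -[x y]; rewrite !inE /rel_in /=.
case: (boolP (adj x y)) => xy /=; last by case: (x \in T); case: (y \in T); case: (x != y).
have -> : x != y by apply: contraTneq xy => ->; rewrite adj_irrefl.
by case: (x \in T); case: (y \in T).
Qed.

Lemma card_inj_in_at (u w : H) (x y : G) :
  u != w -> x \in T -> y \in T -> x != y ->
  (k - 2) ^_ (v - 2) <= #|[set f in inj_in | (f u, f w) == (x, y)]|.
Proof.
move=> uw xT yT xy; pose Hr := {z : H | z \notin [set u; w]}.
pose Tr := T :\: [set x; y].
have cT : #|Tr| = k - 2.
  rewrite cardsD (setIidPr _) ?cards2 ?xy //.
  by apply/subsetP => z; rewrite !inE => /orP[]/eqP->.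
have cH : #|{: Hr}| = v - 2.
  rewrite card_sig /v -(cardsC [set u; w]) cards2 uw addKn.
  by apply: eq_card => z; rewrite !inE.
rewrite -cT -cH -card_inj_ffuns_on.
pose F (g : {ffun Hr -> G}) : {ffun H -> G} :=
  [ffun z => if insub z is Some z' then g z' else if z == u then x else y].
have Fr g (z : Hr) : F g (val z) = g z by rewrite ffunE valK.
have Fu g : F g u = x by rewrite ffunE insubN ?eqxx // !inE eqxx.
have Fw g : F g w = y.
  by rewrite ffunE insubN ?[w == u]eq_sym ?(negPf uw) // !inE eqxx orbT.
have Hcase z : [\/ z = u, z = w | exists z' : Hr, z = val z'].
  have [->|zu] := eqVneq z u; first by constructor 1.
  have [->|zw] := eqVneq z w; first by constructor 2.
  have zr : z \notin [set u; w] by rewrite !inE negb_or zu.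
  by constructor 3; exists (Sub z zr).
have F_inj : injective F.
  by move=> g1 g2 /ffunP E; apply/ffunP => z; have := E (val z); rewrite !Fr.
rewrite -(card_imset _ F_inj); apply/subset_leq_card/subsetP => _ /imsetP[g + ->].
rewrite inE => /andP[/ffun_onP gT /injectiveP gI].
rewrite inE Fu Fw eqxx andbT; apply/inj_inP; split=> [z|].
  by case: (Hcase z) => [->|->|[z' ->]]; rewrite ?Fu ?Fw ?Fr //; have := gT z'; rewrite inE => /andP[].
have gx z : g z != x by have := gT z; rewrite !inE negb_or => /andP[/andP[]].
have gy z : g z != y by have := gT z; rewrite !inE negb_or => /andP[/andP[]].
move=> z1 z2; case: (Hcase z1) => [->|->|[z1' ->]]; case: (Hcase z2) => [->|->|[z2' ->]];
  rewrite ?Fu ?Fw ?Fr //.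
- by move=> xy'; rewrite xy' eqxx in xy.
- by move=> gE; move: (gx z2'); rewrite -gE eqxx.
- by move=> xy'; rewrite xy' eqxx in xy.
- by move=> gE; move: (gy z2'); rewrite -gE eqxx.
- by move=> gE; move: (gx z1'); rewrite gE eqxx.
- by move=> gE; move: (gy z1'); rewrite gE eqxx.
- by move/gI ->.
Qed.

Definition bad (q : H * H) (f : {ffun H -> G}) := ~~ adj (f q.1) (f q.2).

Lemma bad_missing q f : q.1 != q.2 -> f \in inj_in -> bad q f -> (f q.1, f q.2) \in missing.
Proof.
by move=> q12 /inj_inP[fT fI] bf; rewrite inE /= !fT inj_eq // q12.
Qed.

Lemma card_bad_ge q : q.1 != q.2 ->
  #|missing| * (k - 2) ^_ (v - 2) <= #|[set f in inj_in | bad q f]|.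
Proof.
move=> q12; rewrite -sum_nat_const -[X in _ <= X]sum1_card.
rewrite (partition_big (fun f : {ffun H -> G} => (f q.1, f q.2)) (mem missing)); last first.
  by move=> f; rewrite inE => /andP[]; apply: bad_missing.
apply: leq_sum => -[x y] xy; rewrite sum1dep_card.
have := xy; rewrite inE => /and4P[/= xT yT xy' nxy].
apply: leq_trans (card_inj_in_at q12 xT yT xy') _.
apply/subset_leq_card/subsetP => f; rewrite !in_set /bad.
by case/andP=> -> /[dup] /eqP[-> ->]; rewrite nxy.
Qed.

(** The images of [u] and [w] form a missing pair, and the other vertices except [z] have at most
    [k ^ (v - 3)] images. The image of [z] is then a non-neighbour of [f z'], which leaves at most
    [D] options. *)
Lemma card_bad_at_le (u w z z' : H) :
  u != w -> z \notin [set u; w] -> z' != z ->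
  #|[set f in inj_in | ((f u, f w) \in missing) && ~~ adj (f z') (f z)]|
  <= #|missing| * k ^ (v - 3) * D.
Proof.
move=> uw zuw z'z; set F := [set f in _ | _].
have [->|/set0Pn[f0 _]] := eqVneq F set0; first by rewrite cards0.
(* A default vertex of [G], available because [F] is nonempty. *)
pose x0 := f0 u; pose r := restr x0 [set~ z].
have rE f t : t != z -> r f t = f t by move=> tz; rewrite ffunE !inE tz.
have uz : u != z by apply: contraNneq zuw => ->; rewrite !inE eqxx.
have wz : w != z by apply: contraNneq zuw => ->; rewrite !inE eqxx orbT.
apply: (@leq_trans (#|r @: F| * D)).
  apply: card_fibers_le => _ /imsetP[f + ->]; rewrite inE => /andP[/inj_inP[fT _] _].
  pose ev (g : {ffun H -> G}) := g z.
  have ev_inj : {in [set g in F | r g == r f] &, injective ev}.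
    move=> g1 g2; rewrite !inE => /andP[_ /eqP/ffunP r1] /andP[_ /eqP/ffunP r2] ez.
    apply/ffunP => t; have [->//|tz] := eqVneq t z.
    by move: (r1 t) (r2 t); rewrite !rE // => -> ->.
  rewrite -(card_in_imset ev_inj); apply: leq_trans (D_miss (fT z')).
  apply/subset_leq_card/subsetP => _ /imsetP[g + ->].
  rewrite inE => /andP[+ /eqP/ffunP rg]; rewrite inE => /and3P[/inj_inP[gT _] _ ng].
  by have := rg z'; rewrite !rE // => <-; rewrite !inE ng gT.
rewrite leq_mul2r; apply/orP; right.
pose K := ~: [set u; w; z]; pose s (g : {ffun H -> G}) := ((g u, g w), restr x0 K g).
have s_inj : {in r @: F &, injective s}.
  move=> _ _ /imsetP[f1 _ ->] /imsetP[f2 _ ->] [eu ew /ffunP eK]; apply/ffunP => t.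
  have [->//|tu] := eqVneq t u; have [->//|tw] := eqVneq t w.
  have [->|tz] := eqVneq t z; first by rewrite !ffunE !inE eqxx.
  by have := eK t; rewrite !ffunE !inE (negPf tu) (negPf tw) (negPf tz).
have cK : #|K| = v - 3.
  have c3 : #|[set u; w; z]| = 3 by rewrite setUC cardsU1 zuw cards2 uw.
  by rewrite /v -(cardsC [set u; w; z]) c3 addKn.
rewrite -(card_in_imset s_inj) -cK /k -(card_pffun_on x0 (mem K) (mem T)).
rewrite -[X in _ <= _ * X]cardsE -cardsX; apply/subset_leq_card/subsetP => _ /imsetP[_ /imsetP[f + ->] ->].
rewrite inE => /and3P[/inj_inP[fT _] fm _]; rewrite in_setX !rE // fm inE.
apply/pffun_onP; split.
  by apply/subsetP => t; rewrite inE; apply: contraR => tK; rewrite ffunE (negPf tK).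
move=> _ /imageP[t tK ->]; rewrite ffunE tK rE //.
by move: tK; rewrite !inE !negb_or => /andP[].
Qed.
End Missing.

(** With [m] elements of [O] satisfying [c], this is [m <= 1 + m (m - 1)]; keeping a single [q] in
    the outer sum suffices. *)
Lemma sum_le_pairs (I : finType) (O : {set I}) (c : pred I) :
  \sum_(q in O) (c q : nat) <=
  1 + \sum_(q in O) \sum_(r in O | r != q) ((c q && c r) : nat).
Proof.
have [/existsP[q /andP[qO cq]]|/existsPn noc] := boolP [exists q, (q \in O) && c q]; last first.
  by rewrite big1 // => q qO; have := noc q; rewrite qO /=; case: (c q).
rewrite (bigD1 q) //= [X in _ <= 1 + X](bigD1 q) //= cq leq_add //.
by apply: leq_trans (leq_addr _ _).
Qed.

(** * Bonferroni bound for embeddings into a vertex set *)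

Section Bonferroni.
Variables (H G : sgraph) (T : {set G}) (D : nat).
Hypothesis D_miss : forall x, x \in T -> #|T :\: [set y | adj x y]| <= D.

Let v := #|H|.
Let k := #|T|.
Let t := #|missing T|.

(** Orienting by rank excludes reversed pairs, so [q] and [r] are distinct edges and share at most
    one end. *)
Lemma oriented_pair (q r : H * H) : q \in oriented H -> r \in oriented H -> r != q ->
  (r.1 \notin [set q.1; q.2]) || (r.2 \notin [set q.1; q.2]).
Proof.
case: q r => [a b] [c d]; rewrite !inE /= -negb_and => /andP[_ ab] /andP[cd cd'].
apply: contra => /andP[/orP[]/eqP ca /orP[]/eqP db]; subst c d => //.
- by rewrite adj_irrefl in cd.
- by rewrite ltnNge (ltnW ab) in cd'.
- by rewrite adj_irrefl in cd.
Qed.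

Lemma oriented_neq (q : H * H) : q \in oriented H -> q.1 != q.2.
Proof.
by rewrite inE => /andP[qq _]; apply: contraTneq qq => ->; rewrite adj_irrefl.
Qed.

Lemma card_bad_pair (q r : H * H) : q \in oriented H -> r \in oriented H -> r != q ->
  #|[set f in inj_in H T | bad q f && bad r f]| <= t * k ^ (v - 3) * D.
Proof.
move=> qO rO rq; have q12 := oriented_neq qO; have r12 := oriented_neq rO.
have [z [z' [zq zz' badz]]] : exists z z', [/\ z \notin [set q.1; q.2], z' != z &
    forall f : {ffun H -> G}, bad r f -> ~~ adj (f z') (f z)].
  have /orP[r1|r2] := oriented_pair qO rO rq.
    by exists r.1, r.2; split=> // [|f]; [rewrite eq_sym | rewrite adj_sym].
  by exists r.2, r.1.
apply: leq_trans (card_bad_at_le D_miss q12 zq zz').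
apply/subset_leq_card/subsetP => f /setIdP[fI /andP[fq fr]].
by apply/setIdP; rewrite fI badz // (bad_missing q12 fI fq).
Qed.

(** Embeddings into [T] are the injections without bad edge. Inclusion-exclusion, stopped after
    pairs of bad edges, is summed over all injections, with the negative term moved to the left. *)
Lemma card_emb_in_missing :
  #|oriented H| * (t * (k - 2) ^_ (v - 2)) + #|emb_in H T| <=
  k ^_ v + #|oriented H| ^ 2 * (t * k ^ (v - 3) * D).
Proof.
have sumC (P : pred {ffun H -> G}) :
    #|[set f in inj_in H T | P f]| = \sum_(f in inj_in H T) (P f : nat).
  by rewrite -sum1dep_card big_mkcondr; apply: eq_bigr => f _; case: (P f).
have pointwise f : f \in inj_in H T ->
    \sum_(q in oriented H) (bad q f : nat) + (f \in emb_in H T) <=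
    1 + \sum_(q in oriented H) \sum_(r in oriented H | r != q) ((bad q f && bad r f) : nat).
  move=> fI; case: (boolP (f \in emb_in H T)) => [/emb_inP[/embP[_ fh] _]|_].
    rewrite big1 // => q; rewrite inE => /andP[qq _].
    by rewrite /bad fh.
  by rewrite addn0; apply: sum_le_pairs.
have := leq_sum (index_enum _) pointwise; rewrite !big_split /= sum1_card card_inj_in.
rewrite exchange_big /= [X in _ <= _ + X]exchange_big /=.
under eq_bigr do rewrite -sumC.
under [X in _ <= _ + X]eq_bigr => q _.
  rewrite exchange_big /=; under eq_bigr => r _ do rewrite -sumC; over.
have -> : \sum_(f in inj_in H T) (f \in emb_in H T : nat) = #|emb_in H T|.
  rewrite -sumC; apply: eq_card => f; rewrite in_set.
  case: (boolP (f \in emb_in H T)) => fE; rewrite ?andbF // andbT.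
  by have /emb_inP[/embP[fI _] fT] := fE; apply/inj_inP.
move=> le; apply: leq_trans (leq_trans le _); last first.
  rewrite leq_add2l -mulnn -mulnA.
  apply: (@leq_trans (\sum_(q in oriented H) #|oriented H| * (t * k ^ (v - 3) * D))).
    apply: leq_sum => q qO.
    apply: (@leq_trans (\sum_(r in oriented H) t * k ^ (v - 3) * D)).
      rewrite [X in _ <= X](bigD1 q) //=; apply: leq_trans (leq_addl _ _).
      by apply: leq_sum => r /andP[rO rq]; apply: card_bad_pair.
    by rewrite sum_nat_const.
  by rewrite sum_nat_const.
rewrite leq_add2r -sum_nat_const; apply: leq_sum => q qO.
exact/card_bad_ge/oriented_neq.
Qed.
End Bonferroni.

(** * Numerical comparison *)

Lemma ffact_succ (j v : nat) : j.+1 ^_ v.+1 = j ^_ v.+1 + v.+1 * j ^_ v.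
Proof.
rewrite ffactSS ffactnSr [j ^_ v * _]mulnC -mulnDl.
have [vj|jv] := leqP v j; first by congr (_ * _); lia.
by rewrite ffact_small // !muln0.
Qed.

Lemma leq_ffact (m n v : nat) : m <= n -> m ^_ v <= n ^_ v.
Proof.
case: v => [|v] mn; first by rewrite !ffactn0.
by elim: n mn => [|n IHn]; rewrite leq_eqVlt => /predU1P[->//|] // /IHn le;
  rewrite ffact_succ; apply: leq_trans le (leq_addr _ _).
Qed.

(** A discrete mean value theorem: by [ffact_succ] the increment is a sum of [n - m] discrete
    derivatives, each between the extreme ones. *)
Lemma ffact_sub_bounds (m n v : nat) : m <= n ->
  m ^_ v.+1 + (n - m) * (v.+1 * m ^_ v) <= n ^_ v.+1 /\
  n ^_ v.+1 <= m ^_ v.+1 + (n - m) * (v.+1 * n ^_ v).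
Proof.
elim: n => [|n IHn]; first by rewrite leqn0 => /eqP->; rewrite subn0 mul0n addn0.
rewrite leq_eqVlt => /predU1P[->|]; first by rewrite subnn mul0n addn0.
rewrite ltnS => mn; have [IH1 IH2] := IHn mn; rewrite subSn // !mulSn ffact_succ.
have lem : v.+1 * m ^_ v <= v.+1 * n ^_ v by rewrite leq_mul2l leq_ffact.
have len : v.+1 * n ^_ v <= v.+1 * n.+1 ^_ v by rewrite leq_mul2l leq_ffact.
split; first by rewrite addnCA addnC leq_add.
rewrite addnC addnCA leq_add // (leq_trans IH2) // leq_add2l leq_mul2l.
by rewrite len orbT.
Qed.

(** The bound [n ^_ j >= n ^ j (1 - j^2 / n)], cleared of division and subtraction. *)
Lemma ffact_ge (n j : nat) : n ^ j.+1 <= n ^_ j * n + j ^ 2 * n ^ j.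
Proof.
elim: j => [|j IHj]; first by rewrite ffactn0 mul1n expn1 leq_addr.
have [jn|nj] := leqP n j.
  by apply: leq_trans (leq_addl _ _); rewrite expnS leq_mul2r; apply/orP; right; nia.
rewrite ffactnSr; have [r nE] : exists r, n = r + j by exists (n - j); lia.
have -> : n - j = r by lia.
have := leq_mul IHj (leqnn r); have := leq_mul (leqnn j) (leqnn (n ^ j.+1)).
rewrite !(expnS n) mulnDl; move: (n ^_ j) (n ^ j) => A B; nia.
Qed.

(** * Estimates over an ordered field *)

Section Numeric.
Variable F : realFieldType.
Local Open Scope ring_scope.

Lemma bernoulli (x : F) (m : nat) : 0 <= x <= 1 -> 1 - m%:R * x <= (1 - x) ^+ m.
Proof.
move=> x01; elim: m => [|m IHm]; first by rewrite mul0r subr0 expr0.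
rewrite exprSr; apply: le_trans (ler_wpM2r _ IHm); last by lra.
have : 0 <= m%:R :> F by apply: ler0n.
rewrite -natr1; nra.
Qed.

(** The relative gap [s] between [k] and [n] is [c + 1/n] with [c = (4 v^2 M)^-1]: indeed [k^2 >= (1
    - c)(1 - 1/n) n^2 >= (1 - s) n^2]. *)
Lemma numeric_parameters (v M n k : F) :
  3%:R <= v -> M = 48%:R * v ^+ 4 -> 16%:R * v ^+ 4 * M ^+ 2 <= n -> 0 <= k ->
  (1 - (4%:R * v ^+ 2 * M)^-1) * (n ^+ 2 - n) <= k ^+ 2 ->
  exists s, [/\ 0 < n, 0 < s, s * v ^+ 2 <= M^-1 / 3%:R, n * (1 - s) <= k
    & n^-1 * v ^+ 4 <= M^-1 / 768%:R].
Proof.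
move=> v3 ME n_ge k0 klow.
have v0 : 0 < v by lra.
have v2 : 9%:R <= v ^+ 2.
  by rewrite (_ : 9%:R = 3%:R ^+ 2); [rewrite lerXn2r ?nnegrE; lra | ring].
have v4 : v ^+ 2 <= v ^+ 4 by apply: ler_weXn2l => //; lra.
have M1 : 48%:R * v ^+ 2 <= M by rewrite ME; lra.
have M0 : 0 < M by lra.
have n_gt0 : 0 < n by apply: lt_le_trans n_ge; rewrite !mulr_gt0 ?exprn_gt0 ?ltr0n.
pose m := M^-1; have mM : m * M = 1 by rewrite mulVf // gt_eqF.
have m0 : 0 < m by rewrite invr_gt0.
have mv4 : m * v ^+ 4 = 48%:R^-1 by move: mM; rewrite ME; lra.
pose i := n^-1; have inn : i * n = 1 by rewrite mulVf // gt_eqF.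
have i0 : 0 < i by rewrite invr_gt0.
have iv : 16%:R * (i * v ^+ 4) <= m ^+ 2.
  have : i * (16%:R * v ^+ 4 * M ^+ 2) <= 1 by rewrite -[leRHS]inn ler_pM2l.
  move=> h; have -> : 16%:R * (i * v ^+ 4) = i * (16%:R * v ^+ 4 * M ^+ 2) * m ^+ 2.
    transitivity (16%:R * (i * v ^+ 4) * (m * M) ^+ 2); last by ring.
    by rewrite mM expr1n mulr1.
  by rewrite -[leRHS]mul1r ler_wpM2r // sqr_ge0.
pose c := (4%:R * v ^+ 2 * M)^-1.
have cv : 4%:R * (c * v ^+ 2) = m.
  have -> : 4%:R * (c * v ^+ 2) = c * (4%:R * v ^+ 2 * M) * m.
    transitivity (4%:R * (c * v ^+ 2) * (m * M)); last by ring.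
    by rewrite mM mulr1.
  by rewrite mulVf ?mul1r // gt_eqF // !mulr_gt0 ?exprn_gt0 ?ltr0n.
have c0 : 0 < c by rewrite invr_gt0 !mulr_gt0 ?exprn_gt0 ?ltr0n.
pose s := c + i.
have m48 : m <= 48%:R^-1 by rewrite -mv4 -[leLHS]mulr1 ler_pM2l //; lra.
have mm : m ^+ 2 <= m / 48%:R by rewrite expr2 ler_pM2l.
have iv4 : i * v ^+ 4 <= m / 768%:R by lra.
have iv2 : i * v ^+ 2 <= m / 768%:R by apply: le_trans _ iv4; rewrite ler_pM2l.
have sv2 : s * v ^+ 2 <= m / 3%:R by move: cv iv2; rewrite /s; clear -m0; lra.
have s0 : 0 < s by rewrite addr_gt0.
have s9 : 9%:R * s <= m / 3%:R by apply: le_trans _ sv2; rewrite mulrC ler_pM2l.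
have nE : n ^+ 2 - n = n ^+ 2 * (1 - i).
  by rewrite mulrBr mulr1 expr2 -mulrA [n * i]mulrC inn mulr1.
exists s; split=> //.
  rewrite -(ler_pXn2r (_ : (0 < 2)%N)) ?nnegrE //; last first.
    by rewrite mulr_ge0 ?(ltW n_gt0) //; move: s9 m48 s0; clear; lra.
  apply: le_trans _ klow; rewrite -/c nE exprMn [leRHS]mulrCA ler_pM2l ?exprn_gt0 //.
  have : 0 <= c * i by rewrite mulr_ge0 ?ltW.
  move=> ci; apply: (@le_trans _ _ (1 - s)); last by move: ci; rewrite /s; clear; lra.
  by rewrite expr2 -[leRHS]mul1r ler_wpM2r //; move: s9 m48 s0; clear; lra.
Qed.

(** [E >= (v + 1) / 2] puts the main term 1/2 above [v / 2]. The two error terms take at most 1/16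
    each, by [v ^+ 4 <= k / 16] and [m * v ^+ 4 = 1/48], which leaves 3/8. *)
Lemma missing_coefficient (v m E k Z : F) :
  3%:R <= v -> v + 1 <= 2%:R * E -> E <= v ^+ 2 -> 0 < m -> m * v ^+ 4 = 48%:R^-1 ->
  16%:R * v ^+ 4 <= k -> 0 <= Z ->
  k * Z * (v / 2%:R + 3%:R / 8%:R) <= E * Z * (k - v ^+ 2) - E ^+ 2 * Z * (3%:R * k * m).
Proof.
move=> v3 vE Ev m0 mv4 vk Z0.
have v4E : v ^+ 4 = v ^+ 2 ^+ 2 by ring.
have E0 : 0 <= E by lra.
have v20 : 0 <= v ^+ 2 by apply: sqr_ge0.
have k0 : 0 <= k by apply: le_trans vk; rewrite mulr_ge0 // v4E sqr_ge0.
have E2 : E ^+ 2 <= v ^+ 4 by rewrite v4E lerXn2r.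
have Em : E ^+ 2 * m * k <= 48%:R^-1 * k by rewrite ler_wpM2r // -mv4 mulrC ler_pM2l.
have Evv : E * v ^+ 2 <= v ^+ 4 by rewrite v4E expr2 ler_wpM2r.
have Ek : (v + 1) * k <= 2%:R * E * k by rewrite ler_wpM2r.
rewrite -subr_ge0.
have -> : E * Z * (k - v ^+ 2) - E ^+ 2 * Z * (3%:R * k * m) - k * Z * (v / 2%:R + 3%:R / 8%:R)
   = Z * (E * k - E * v ^+ 2 - 3%:R * (E ^+ 2 * m * k) - k * (v / 2%:R + 3%:R / 8%:R)) by ring.
apply: mulr_ge0 => //; move: Em Evv Ek vk; clear; lra.
Qed.

(** For [n < k]. Up to a factor [k ^+ (v - 2)], the left side bounds the slope of [k ^_ v], and the
    right side is the loss from the missing pairs forced by each unit of [k - n]. *)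
Lemma upper_slope (v m n k : F) :
  3%:R <= v -> 0 < m -> m * v <= 48%:R^-1 -> 3%:R * m <= 48%:R^-1 ->
  16%:R * v <= k -> 0 < n -> (1 - 6%:R * m) * k ^+ 2 <= n ^+ 2 - n ->
  v * k < (v / 2%:R + 3%:R / 8%:R) * (k + n - 1).
Proof.
move=> v3 m0 mv m48 vk n0 kup; have k0 : 0 < k by lra.
have m6 : 0 <= 1 - 6%:R * m by lra.
have n6 : k * (1 - 6%:R * m) <= n.
  have n60 : 0 <= k * (1 - 6%:R * m) by rewrite mulr_ge0 // ltW.
  rewrite -(ler_pXn2r (_ : (0 < 2)%N)) ?nnegrE ?(ltW n0) //.
  apply: le_trans (_ : n ^+ 2 - n <= _); last by move: n0; clear; lra.
  apply: le_trans _ kup; rewrite exprMn mulrC ler_pM2r ?exprn_gt0 //.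
  by rewrite expr2 ler_piMl //; move: m0; clear; lra.
have mvk : m * v * k <= 48%:R^-1 * k by rewrite ler_pM2r.
have mk : 3%:R * m * k <= 48%:R^-1 * k by rewrite ler_pM2r.
apply: lt_le_trans (_ : (v / 2%:R + 3%:R / 8%:R) * (2%:R * k - 6%:R * m * k - 1) <= _).
  by move: mvk mk vk v3 k0; clear; lra.
rewrite ler_pM2l; first by move: n6; clear; lra.
by move: v3; clear; lra.
Qed.

(** For [k <= n], with [X] and [Y] the powers [v - 2] of [k] and [n]. The left side bounds what arcs
    outside the core bring per unit of [n - k], the right side is a lower slope of the falling
    factorial. The saved [m / 2] pays for the errors. *)
Lemma lower_slope (v m s n k X Y : F) :
  3%:R <= v -> 0 < m -> 0 < n -> 0 < s -> 0 < X -> 0 < Y ->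
  s * v ^+ 2 <= m / 3%:R -> 3%:R * (s * v) <= m / 3%:R -> 3%:R * m <= 48%:R^-1 ->
  n^-1 * v ^+ 4 <= m / 768%:R -> v ^+ 2 <= v ^+ 4 -> v ^+ 3 <= v ^+ 4 ->
  n * (1 - s) <= k -> k <= n -> Y * (1 - v * s) <= X ->
  (v / 2%:R - m / 2%:R) * Y * (n + k - 1) < v * (X * (k - v ^+ 2)).
Proof.
move=> v3 m0 n0 s0 X0 Y0 sv2 sv m48 iv4 v24 v34 kn kn' XY.
have v0 : 0 < v by lra.
set i := n^-1 in iv4; have inn : i * n = 1 by rewrite mulVf // gt_eqF.
have i0 : 0 < i by rewrite invr_gt0.
have s9 : 3%:R * s <= s * v by rewrite mulrC ler_pM2l.
pose d := 1 - s - v ^+ 2 * i.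
have iv2 : v ^+ 2 * i <= i * v ^+ 4 by rewrite mulrC ler_pM2l.
have d0 : 0 <= d by rewrite /d; move: iv2 iv4 sv m48 m0 s9; clear; lra.
have vs0 : 0 <= 1 - v * s by move: sv m48; clear; lra.
have nd : n * d <= k - v ^+ 2.
  have : n * (v ^+ 2 * i) = v ^+ 2 * (i * n) by ring.
  by rewrite inn mulr1 /d; move: kn; clear; lra.
have nd0 : 0 <= n * d by rewrite mulr_ge0 // ltW.
have le1 : Y * (1 - v * s) * (n * d) <= X * (k - v ^+ 2).
  by rewrite ler_pM // mulr_ge0 // ltW.
have vd : v - m < v * ((1 - v * s) * d).
  have : 0 <= v * (v * s * (s + v ^+ 2 * i)).
    have vi : 0 <= v ^+ 2 * i by rewrite mulr_ge0 ?sqr_ge0 ?ltW.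
    by rewrite !mulr_ge0 ?addr_ge0 ?(ltW v0) ?(ltW s0).
  have : v * (v ^+ 2 * i) <= i * v ^+ 4 by rewrite mulrA -exprS mulrC ler_pM2l.
  by rewrite /d; move: sv sv2 iv4 m0; clear; lra.
have Yn : 0 < Y * n by rewrite mulr_gt0.
apply: (@lt_le_trans _ _ (v * (Y * (1 - v * s) * (n * d)))); last by rewrite ler_pM2l.
have -> : v * (Y * (1 - v * s) * (n * d)) = Y * n * (v * ((1 - v * s) * d)) by ring.
apply: (@le_lt_trans _ _ (Y * n * (v - m))); last by rewrite ltr_pM2l.
have -> : (v / 2%:R - m / 2%:R) * Y * (n + k - 1) = Y * (v - m) * ((n + k - 1) / 2%:R) by ring.
rewrite [leRHS]mulrAC ler_pM2l; first by move: kn'; clear; lra.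
by rewrite mulr_gt0 //; move: v3 m48; clear; lra.
Qed.

(* [Fn] and [Fk] stand for [n ^_ v] and [k ^_ v], where [k] is the size of the
   core, [t] for the number of ordered adjacent pairs not inside the core, [t'] for
   the number of ordered pairs missing inside it. *)
Lemma extremal_numeric (w : nat) (M E n k t t' Fn Fk : F) :
  let v : F := w.+3%:R in
  M = 48%:R * v ^+ 4 -> v + 1 <= 2%:R * E -> E <= v ^+ 2 ->
  16%:R * v ^+ 4 * M ^+ 2 <= n -> 0 <= k ->
  (1 - (4%:R * v ^+ 2 * M)^-1) * (n ^+ 2 - n) <= k ^+ 2 ->
  (1 - 6%:R / M) * k ^+ 2 <= n ^+ 2 - n ->
  0 <= t -> 0 <= t' -> t' - t = k ^+ 2 - k - (n ^+ 2 - n) ->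
  Fn <= Fk - E * t' * k ^+ w * (k - v ^+ 2) + E ^+ 2 * t' * k ^+ w * (3%:R * k / M)
        + (v / 2%:R - (2%:R * M)^-1) * n ^+ w.+1 * t ->
  (n <= k -> Fk - Fn <= (k - n) * v * k ^+ w.+2) ->
  (k <= n -> (n - k) * v * (k ^+ w.+1 * (k - v ^+ 2)) <= Fn - Fk) ->
  t = 0 /\ k = n.
Proof.
move=> v ME vE Ev n_ge k0 klow kup t0 t'0 tt' + up low.
have v3 : 3%:R <= v by rewrite /v ler_nat.
have wv : w.+1%:R <= v by rewrite /v ler_nat (leqW (leqnSn _)).
move: v ME vE Ev n_ge klow up low v3 wv => v ME vE Ev n_ge klow up low v3 wv.
have [s [n0 s0 sv2 kn iv4]] := numeric_parameters v3 ME n_ge k0 klow.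
have mE : (2%:R * M)^-1 = M^-1 / 2%:R by rewrite invfM mulrC.
rewrite mE; move: kup sv2 iv4.
have v0 : 0 < v by move: v3; clear; lra.
have M0 : 0 < M by rewrite ME mulr_gt0 ?exprn_gt0 ?ltr0n.
have mM : M^-1 * M = 1 by rewrite mulVf // gt_eqF.
have m0 : 0 < M^-1 by rewrite invr_gt0.
have mv4 : M^-1 * v ^+ 4 = 48%:R^-1 by rewrite ME invfM -mulrA mulVf ?mulr1 // gt_eqF ?exprn_gt0.
move: (M^-1) mM m0 mv4 {mE klow n_ge ME} => m mM m0 mv4 kup sv2 iv4.
have v1 : 1 <= v by move: v3; clear; lra.
have v24 : v ^+ 2 <= v ^+ 4 by rewrite ler_weXn2l.
have v34 : v ^+ 3 <= v ^+ 4 by rewrite ler_weXn2l.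
have v14 : v <= v ^+ 4 by rewrite ler_eXnr.
have mv : m * v <= 48%:R^-1 by rewrite -mv4 ler_pM2l.
have m48 : 3%:R * m <= 48%:R^-1 by apply: le_trans _ mv; rewrite mulrC ler_pM2l.
have sv : 3%:R * (s * v) <= m / 3%:R.
  by apply: le_trans _ sv2; rewrite mulrCA ler_pM2l // expr2 ler_pM2r.
have s9 : 3%:R * s <= s * v by rewrite mulrC ler_pM2l.
have s1 : 3%:R * s <= 1 by move: s9 sv m48; clear; lra.
have v4k : 16%:R * v ^+ 4 <= k.
  have : n^-1 * v ^+ 4 * n <= m / 768%:R * n by rewrite ler_pM2r.
  rewrite mulrAC mulVf ?gt_eqF // mul1r => v4n.
  have : 3%:R * m * n <= 48%:R^-1 * n by rewrite ler_pM2r.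
  have : 3%:R * s * n <= 1 * n by rewrite ler_pM2r.
  by move: v4n kn n0; clear; lra.
have vk : 16%:R * v <= k by move: v4k v14; clear; lra.
have k_gt0 : 0 < k by move: vk v0; clear; lra.
have Z0 : 0 < k ^+ w by rewrite exprn_gt0.
have XE : k ^+ w.+1 = k * k ^+ w by rewrite exprS.
have X0 : 0 < k ^+ w.+1 by rewrite exprn_gt0.
have Y0 : 0 < n ^+ w.+1 by rewrite exprn_gt0.
have XY : n ^+ w.+1 * (1 - v * s) <= k ^+ w.+1.
  have le1 : (n * (1 - s)) ^+ w.+1 <= k ^+ w.+1.
    by apply: lerXn2r => //; rewrite nnegrE mulr_ge0 ?ltW //; move: s1 s0; clear; lra.
  apply: le_trans _ le1; rewrite exprMn ler_pM2l //.
  apply: le_trans (_ : 1 - w.+1%:R * s <= _); last first.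
    by apply: bernoulli; move: s1 s0; clear; lra.
  by rewrite lerD2l lerN2 ler_pM2r.
have coef := missing_coefficient v3 vE Ev m0 mv4 v4k (ltW Z0).
rewrite -XE in coef; rewrite exprS in up.
move: (n ^+ w.+1) (k ^+ w.+1) (k ^+ w) Y0 X0 Z0 XY coef up low {XE wv}.
move=> Y X Z Y0 X0 Z0 XY coef up low main.
have {}main : Fn <= Fk - X * (v / 2%:R + 3%:R / 8%:R) * t' + (v / 2%:R - m / 2%:R) * Y * t.
  by move: main (ler_wpM2r t'0 coef); clear; lra.
(* Measured in [n ^+ (v - 2)], a missing pair costs 1/8 more than the [v / 2] that an outside arc
   could bring. *)
have ab : (v / 2%:R + 8%:R^-1) * Y <= X * (v / 2%:R + 3%:R / 8%:R).
  apply: le_trans (_ : Y * (1 - v * s) * (v / 2%:R + 3%:R / 8%:R) <= _).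
    by rewrite -mulrA mulrC ler_pM2l //; move: sv sv2 m48; clear; lra.
  by rewrite ler_pM2r //; move: v0; clear; lra.
have tab := ler_wpM2r t0 ab; have tab' := ler_wpM2r t'0 ab.
have Yt : 0 <= Y * t by rewrite mulr_ge0 // ltW.
have Yt' : 0 <= Y * t' by rewrite mulr_ge0 // ltW.
have mYt : 0 <= m * (Y * t) by rewrite mulr_ge0 // ltW.
have mYt' : 0 <= m * (Y * t') by rewrite mulr_ge0 // ltW.
(* A core with more than [n] vertices forces missing pairs that outweigh its gain in [Fk]. *)
have [nk|kn'] := ltP n k.
  exfalso; have brack := upper_slope v3 m0 mv m48 vk n0 kup.
  have kn0 : 0 < (k - n) * X by rewrite mulr_gt0 // subr_gt0.
  have : (k - n) * X * (v * k) < (k - n) * X * ((v / 2%:R + 3%:R / 8%:R) * (k + n - 1)).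
    by rewrite ltr_pM2l.
  have t'E : t' = t + (k - n) * (k + n - 1) by move: tt'; clear; lra.
  by move: main (up (ltW nk)) tab Yt mYt; rewrite t'E; clear; lra.
have tE : t = t' + (n - k) * (n + k - 1) by move: tt'; clear; lra.
have := lower_slope v3 m0 n0 s0 X0 Y0 sv2 sv m48 iv4 v24 v34 kn kn' XY.
rewrite -subr_gt0 => brack.
(* A gap [k < n] would make [Fn - Fk] exceed what the outside arcs bring. *)
have nk0 : n - k = 0.
  apply/eqP; rewrite eq_le subr_ge0 kn' andbT leNgt; apply/negP => nk.
  by move: (mulr_gt0 nk brack) (low kn') main tab' Yt' mYt'; rewrite tE; clear; lra.
have kE : k = n by move: nk0; clear; lra.
have tt : t = t' by rewrite tE nk0 mul0r addr0.
have := low kn'; rewrite nk0 !mul0r => Fkn; split=> //; rewrite tt.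
have : Y * t' <= 0 by move: main Fkn tab' mYt'; rewrite tt; clear; lra.
by rewrite pmulr_rle0 // => t'n; apply/eqP; rewrite eq_le t'n.
Qed.
End Numeric.

Lemma ffact_pred_ge (k w : nat) : k ^ w.+1 <= (k - 2) ^_ w.+1 + w.+3 ^ 2 * k ^ w.
Proof.
case: k => [|[|k]]; first by rewrite exp0n.
  by rewrite !exp1n muln1 ffact0n add0n expn_gt0.
have := ffact_ge k.+2 w.+3; rewrite subn2 /= !ffactSS => le1.
have k0 : 0 < k.+2 ^ 3 by rewrite expn_gt0.
rewrite -(leq_pmul2l k0) -expnD mulnDr; apply: leq_trans le1 _; rewrite addnC addnC.
apply: leq_add; last by rewrite mulnCA -expnD.
move: (k ^_ w.+1) => B; rewrite !expnS expn0; nia.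
Qed.

Lemma ffact_ge_pred (k w : nat) : k ^ w.+2 <= k ^_ w.+2 + w.+3 ^ 2 * k ^ w.+1.
Proof.
case: k => [|k]; first by rewrite exp0n.
rewrite -(leq_pmul2r (ltn0Sn k)) -expnSr.
apply: leq_trans (ffact_ge _ _) _; rewrite mulnDl leq_add2l -mulnA -expnSr.
by rewrite leq_mul2r leq_exp2r // leqnSn orbT.
Qed.

(** Since [N >= n^v (1 - v^2 / n)] and [P <= n^2], the bound on [N ^ 2] yields
    [h >= (1 - v^2 / n)^2 P^2], and [n >= 2 Q v^2] makes this factor at least [1 - 1/Q]. *)
Lemma hom_bound_numeric (n v P h N Q : nat) :
  1 < v -> P <= n ^ 2 -> 0 < P -> n ^_ v <= N -> N ^ 2 <= P ^ (v - 2) * h ->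
  2 * Q * v ^ 2 <= n -> Q * P ^ 2 <= Q * h + P ^ 2.
Proof.
move=> v1 Pn P0 nN Nh Qn; rewrite leqNgt; apply/negP => lt.
have n0 : 0 < n.
  by rewrite lt0n; apply: contraTneq P0 => n0; move: Pn; rewrite n0 leqn0 => /eqP->.
have Ar : n ^ v * (n - v ^ 2) <= N * n.
  apply: leq_trans (leq_mul nN (leqnn n)); rewrite mulnBr leq_subLR addnC -expnSr.
  by rewrite [n ^ v * v ^ 2]mulnC ffact_ge.
have Pv : P ^ (v - 2) * P ^ 2 <= (n ^ v) ^ 2.
  rewrite -expnD subnK // -expnM mulnC expnM.
  by case: v {nN Nh Qn Ar} v1 => // v' _; rewrite leq_exp2r.
have A0 : 0 < (n ^ v) ^ 2 by rewrite !expn_gt0 n0.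
have B0 : 0 < P ^ (v - 2) by rewrite expn_gt0 P0.
have h1 : (n ^ v) ^ 2 * (n - v ^ 2) ^ 2 <= P ^ (v - 2) * h * n ^ 2.
  by rewrite -expnMn (leq_trans (_ : _ <= (N * n) ^ 2)) ?leq_sqr // expnMn leq_mul2r Nh orbT.
move: (P ^ (v - 2)) ((n ^ v) ^ 2) Pv A0 B0 h1 => B A Pv A0 B0 h1.
have h2 : Q * (n - v ^ 2) ^ 2 < Q.-1 * n ^ 2.
  rewrite -(ltn_pmul2l A0).
  apply: (@leq_ltn_trans (Q * h * (B * n ^ 2))).
    by rewrite mulnCA; apply: leq_trans (leq_mul (leqnn Q) h1) _; apply/eq_leq; ring.
  apply: (@leq_trans (Q.-1 * P ^ 2 * (B * n ^ 2))).
    by rewrite ltn_pmul2r ?muln_gt0 ?B0 ?expn_gt0 ?n0 //; case: Q lt {Qn} => //= q; lia.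
  have -> : Q.-1 * P ^ 2 * (B * n ^ 2) = B * P ^ 2 * (Q.-1 * n ^ 2) by ring.
  by rewrite leq_mul2r Pv orbT.
have Q0 : 0 < Q by case: Q h2 {Qn lt}.
have vn : v ^ 2 <= n by apply: leq_trans Qn; nia.
have [r nE] : exists r, n = r + v ^ 2 by exists (n - v ^ 2); lia.
move: h2 Qn; rewrite nE addnK; case: Q Q0 {lt nE} => // q _; move: (v ^ 2) => v2 /=.
nia.
Qed.

Section NumericNat.
Variable F : realFieldType.
Local Open Scope ring_scope.

(** Casts the division-free counting inequalities into [F] for [extremal_numeric], replacing [D] by
    [3 k / M] and powers by falling factorials or conversely. *)
Lemma extremal_numeric_nat (w n k E D VT t' N NT : nat) :
  let v := w.+3 in let M := (48 * v ^ 4)%N in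
  (v < 2 * E)%N -> (E <= v ^ 2)%N -> (16 * v ^ 4 * M ^ 2 <= n)%N ->
  (8 * v ^ 2 * M ^ 2 * (n * n.-1) <= 8 * v ^ 2 * M ^ 2 * k ^ 2 + 2 * M * (n * n.-1))%N ->
  (M * k ^ 2 <= M * (n * n.-1) + 6 * k ^ 2)%N ->
  (VT <= n * n.-1)%N -> (VT + t' = k * k.-1)%N -> (M * D <= 3 * k)%N ->
  (n ^_ v <= N)%N ->
  (M.*2 * N + (v * M).-1 * n ^ w.+1 * VT <= M.*2 * NT + (v * M).-1 * n ^ w.+1 * (n * n.-1))%N ->
  (E * (t' * (k - 2) ^_ w.+1) + NT <= k ^_ v + E ^ 2 * (t' * k ^ w * D))%N ->
  VT = (n * n.-1)%N /\ k = n.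
Proof.
move=> v M vE Ev n_ge kge kle VTn VTt MD nN remove miss.
have M0 : (0 < M)%N by rewrite /M muln_gt0 expn_gt0.
have n0 : (0 < n)%N by apply: leq_trans n_ge; rewrite ?muln_gt0 ?expn_gt0 ?M0.
have predE (x : nat) : (x * x.-1)%N%:R = x%:R ^+ 2 - x%:R :> F.
  by case: x => [|x]; rewrite ?mul0n ?expr0n ?subr0 //= natrM -natr1; ring.
have [P PE] : exists P, P = (n * n.-1)%N by exists (n * n.-1)%N.
have PR : P%:R = n%:R ^+ 2 - n%:R :> F by rewrite PE predE.
rewrite -PE in kge kle VTn remove *.
have natr_sqr (x : nat) : (x ^ 2)%:R = x%:R ^+ 2 :> F by rewrite natrX.
have qR : (8 * v ^ 2 * M ^ 2)%:R = 8%:R * v%:R ^+ 2 * M%:R ^+ 2 :> F.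
  by rewrite -!natr_sqr -!natrM.
move: (8 * v ^ 2 * M ^ 2)%N qR kge => q qR kge.
pose t : F := P%:R - VT%:R.
have vE' : v%:R = w.+3%:R :> F by [].
have MR : M%:R = 48%:R * v%:R ^+ 4 :> F by rewrite /M natrM natrX.
have vER : v%:R + 1 <= 2%:R * E%:R :> F by rewrite natr1 -natrM ler_nat.
have EvR : E%:R <= v%:R ^+ 2 :> F by rewrite -natrX ler_nat.
have n_geR : 16%:R * v%:R ^+ 4 * M%:R ^+ 2 <= n%:R :> F.
  by rewrite -!natrX -!natrM ler_nat.
clearbody M; clear vE Ev n_ge.
have MR0 : 0 < M%:R :> F by rewrite ltr0n.
have v0 : 0 < v%:R :> F by rewrite ltr0n.
pose m : F := M%:R^-1; have mM : m * M%:R = 1 by rewrite mulVf // gt_eqF.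
have kw0 : 0 <= (k ^ w)%:R :> F by rewrite ler0n.
have t0 : 0 <= t by rewrite /t subr_ge0 ler_nat.
have t'0 : 0 <= t'%:R :> F by rewrite ler0n.
have [|||||||||||||tz kn] := @extremal_numeric F w M%:R E%:R n%:R k%:R t t'%:R (n ^_ v)%:R (k ^_ v)%:R.
- exact: MR.
- exact: vER.
- exact: EvR.
- exact: n_geR.
- exact: ler0n.
- rewrite -/v -PR; move: kge; rewrite -(ler_nat F) natrD.
  rewrite [(q * P)%:R]natrM [(q * _)%:R]natrM natr_sqr qR [(2 * M * P)%:R]natrM [(2 * M)%:R]natrM.
  (* Dividing [2 * M * P] by [8 v^2 M^2] gives [c * P]. *)
  set c := (_ * _ * _)^-1; have cM : 4%:R * v%:R ^+ 2 * M%:R * c = 1.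
    by rewrite mulfV // gt_eqF // !mulr_gt0 ?exprn_gt0.
  have q0 : 0 < 8%:R * v%:R ^+ 2 * M%:R ^+ 2 :> F by rewrite !mulr_gt0 ?exprn_gt0.
  move=> kge; rewrite -(ler_pM2l q0) mulrA mulrBr mulr1.
  have -> : 8%:R * v%:R ^+ 2 * M%:R ^+ 2 * c = 2%:R * M%:R * (4%:R * v%:R ^+ 2 * M%:R * c) by ring.
  by rewrite cM mulr1 mulrBl; lra.
- rewrite -PR; move: kle; rewrite -(ler_nat F) natrD.
  rewrite [(M * k ^ 2)%:R]natrM [(M * P)%:R]natrM [(6 * _)%:R]natrM natr_sqr => kle.
  rewrite -(ler_pM2l MR0) -/m.
  have -> : M%:R * ((1 - 6%:R * m) * k%:R ^+ 2) = (M%:R - 6%:R * (m * M%:R)) * k%:R ^+ 2 by ring.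
  by rewrite mM; lra.
- exact: t0.
- exact: t'0.
- rewrite -PR; by move: VTt => /(congr1 (fun x => x%:R : F)); rewrite natrD predE /t; lra.
- have nN' : (n ^_ v)%:R <= N%:R :> F by rewrite ler_nat.
  (* The coefficient is [(v M - 1) / (2 M)]. *)
  have : N%:R <= NT%:R + (v%:R / 2%:R - (2%:R * M%:R)^-1) * n%:R ^+ w.+1 * t.
    have YR : (n ^ w.+1)%:R = n%:R ^+ w.+1 :> F by rewrite natrX.
    move: remove; rewrite -muln2; move: (n ^ w.+1)%N YR => Yn <-.
    rewrite -(ler_nat F) !natrD !natrM.
    have -> : (v * M).-1%:R = v%:R * M%:R - 1 :> F.
      by rewrite -natrM -subn1 natrB // muln_gt0.
    set y := Yn%:R => rem.
    set c := (2%:R * M%:R)^-1; have cM : 2%:R * M%:R * c = 1.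
      by rewrite mulfV // gt_eqF // mulr_gt0.
    have M2 : 0 < M%:R * 2%:R :> F by rewrite mulr_gt0.
    rewrite -(ler_pM2l M2).
    have -> : M%:R * 2%:R * (NT%:R + (v%:R / 2%:R - c) * y * t) =
       M%:R * 2%:R * NT%:R + (v%:R * M%:R - 2%:R * M%:R * c) * y * t by field.
    by rewrite cM /t; lra.
  have : E%:R * (t'%:R * ((k ^ w)%:R * (k%:R - v%:R ^+ 2))) <= E%:R * (t'%:R * ((k - 2) ^_ w.+1)%:R) :> F.
    rewrite !ler_wpM2l ?ler0n //.
    have := ffact_pred_ge k w; rewrite expnS -/v -natr_sqr.
    move: (v ^ 2)%N (k ^ w)%N ((k - 2) ^_ w.+1)%N => v2 Z B.
    by rewrite -(ler_nat F) natrD !natrM; lra.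
  have : E%:R ^+ 2 * (t'%:R * (k ^ w)%:R * D%:R) <= E%:R ^+ 2 * (t'%:R * (k ^ w)%:R * (3%:R * k%:R / M%:R)) :> F.
    rewrite !ler_wpM2l ?exprn_ge0 ?mulr_ge0 ?ler0n //.
    by rewrite ler_pdivlMr // mulrC -!natrM ler_nat.
  rewrite -vE'; move: nN' miss; rewrite -(natrX _ k w) -(natr_sqr E).
  move: (E ^ 2)%N (k ^ w)%N (k ^_ v)%N (n ^_ v)%N ((k - 2) ^_ w.+1)%N => E2 Z Fk Fn B nN'.
  by rewrite -(ler_nat F) !natrD !natrM; lra.
- rewrite -vE' ler_nat => nk.
  have le2 : (k%:R - n%:R) * (v%:R * (k ^_ w.+2)%:R) <= (k%:R - n%:R) * (v%:R * k%:R ^+ w.+2) :> F.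
    by rewrite !ler_wpM2l ?subr_ge0 ?ler_nat ?ler0n // -natrX ler_nat ffact_leq_expn.
  have [_] := ffact_sub_bounds w.+2 nk; rewrite -/v -mulrA; move: le2.
  move: (k ^_ w.+2)%N (k ^_ v)%N (n ^_ v)%N => K Fk Fn le2.
  by rewrite -(ler_nat F) natrD !natrM natrB //; lra.
- rewrite -vE' ler_nat => kn.
  have le2 : (n%:R - k%:R) * (v%:R * (k%:R ^+ w.+1 * (k%:R - v%:R ^+ 2))) <= (n%:R - k%:R) * (v%:R * (k ^_ w.+2)%:R) :> F.
    rewrite !ler_wpM2l ?subr_ge0 ?ler_nat ?ler0n //.
    have := ffact_ge_pred k w; rewrite (expnS k w.+1) -/v -natr_sqr -natrX.
    move: (v ^ 2)%N (k ^ w.+1)%N (k ^_ w.+2)%N => v2 Z B.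
    by rewrite -(ler_nat F) natrD !natrM; lra.
  have [+ _] := ffact_sub_bounds w.+2 kn; rewrite -/v -mulrA; move: le2.
  move: (k ^_ w.+2)%N (k ^_ v)%N (n ^_ v)%N => K Fk Fn le2.
  by rewrite -(ler_nat F) natrD !natrM natrB //; lra.
split; last by move/eqP: kn; rewrite eqr_nat => /eqP.
by move/eqP: tz; rewrite /t subr_eq0 eqr_nat => /eqP ->.
Qed.
End NumericNat.

(** * Sufficiency *)

Section Extremal.
Variables (H : sgraph) (p : H -> H) (a b : H).
Hypotheses (isoH : no_isolated H) (p_inj : injective p).
Hypotheses (p_adj : forall u, adj u (p u)) (ab : adj a b) (bpa : b != p a).

Let v := #|H|.
(** [M] makes [v^4 / M] equal to 1/48; [Q] satisfies [2 M / Q = 1 / (4 v^2 M)], and [2 Q v^2] is the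
    threshold for [n]. *)
Let M := 48 * v ^ 4.
Let Q := 8 * v ^ 2 * M ^ 2.

Let v_gt2 : 2 < v := gt2_card p_adj ab bpa.

Lemma emb_in_setT (G : sgraph) : emb_in H [set: G] = Emb H G.
Proof.
apply/setP => f; apply/emb_inP/idP => [[]//|fE]; split=> // u; apply: in_setT.
Qed.

Lemma extremal_core (G : sgraph) (n : nat) :
  16 * v ^ 4 * M ^ 2 < n -> has_size 'C(n, 2) G -> n ^_ v <= #|Emb H G| ->
  vol (rel_in (@adj G) (core (@adj G) M)) = vol (@adj G) /\ #|core (@adj G) M| = n.
Proof.
move=> n_gt [isoG /edges_vol volG] leN.
have v0 : 0 < v by apply: leq_trans v_gt2.
have v4 : 0 < v ^ 4 by rewrite expn_gt0 v0.
have M18 : 18 <= M by rewrite /M; lia.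
have MQ : M ^ 2 <= Q by rewrite /Q leq_pmull // muln_gt0 expn_gt0 v0.
have n1 : 1 < n by lia.
have P0 : 0 < vol (@adj G) by rewrite volG; case: n n1 {n_gt volG leN} => [|[|n]].
have Pn : vol (@adj G) <= n ^ 2 by rewrite volG -mulnn leq_mul2l leq_pred orbT.
have h4 : Q * vol (@adj G) ^ 2 <=
    Q * (\sum_x deg (@adj G) x * rho (@adj G) x) + vol (@adj G) ^ 2.
  apply: (@hom_bound_numeric n v) leN _ _ => //; first exact: ltnW.
    apply: leq_trans (sqr_homs (@adj_sym G) p_inj p_adj ab bpa).
    rewrite leq_sqr; apply/subset_leq_card/subsetP => f /embP[_ fh].
    exact/homsP.
  by apply: leq_trans (ltnW n_gt); apply/eq_leq; rewrite /Q; ring.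
set T := core (@adj G) M.
have [w vE] : exists w, v = w.+3 by exists (v - 3); lia.
have miss x : x \in T -> #|T :\: [set y | adj x y]| <= 3 * #|T| %/ M.
  move=> xT; rewrite leq_divRL; last by lia.
  by rewrite mulnC; apply: core_miss xT; [apply: adj_sym|..|exact: h4].
have volT := card_missing T.
have bonf := card_emb_in_missing H miss.
have rem : M.*2 * #|Emb H G| + (v * M).-1 * n ^ (v - 2) * vol (rel_in (@adj G) T) <=
    M.*2 * #|emb_in H T| + (v * M).-1 * n ^ (v - 2) * (n * n.-1).
  rewrite -volG -emb_in_setT.
  have := card_emb_in_core p_inj p_adj ab bpa _ Pn (subsetT T).
  have M0 : 0 < M by apply: leq_trans M18.
  move/(_ M0)/leq_trans; apply.
  by rewrite leq_add2l leq_mul2l vol_rel_in orbT.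
have E1 : v < 2 * #|oriented H|.
  by rewrite mul2n -vol_oriented; apply: vol_gt_card isoH ab (p_adj a) bpa.
have E2 : #|oriented H| <= v ^ 2.
  by apply: leq_trans (max_card _) _; rewrite card_prod.
have ge := core_card_ge (@adj_sym G) M18 MQ P0 h4.
have le := core_card_le (@adj_sym G) M18 MQ P0 h4.
have le' := vol_rel_in (@adj G) T.
have e2 : v - 2 = w.+1 by rewrite vE.
have e3 : v - 3 = w by rewrite vE !subSS subn0.
rewrite volG in ge le le' *; rewrite -/v e2 in rem bonf; rewrite e3 in bonf.
have := @extremal_numeric_nat rat w n #|T| #|oriented H| (3 * #|T| %/ M)
  (vol (rel_in (@adj G) T)) #|missing T| #|Emb H G| #|emb_in H T|.
cbv zeta; rewrite -vE -/M; apply=> //; first exact: ltnW.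
by rewrite mulnC leq_divM.
Qed.
End Extremal.

Lemma vol_rel_in_eq (G : sgraph) (T : {set G}) : no_isolated G ->
  vol (rel_in (@adj G) T) = vol (@adj G) -> T = setT.
Proof.
move=> isoG eqT; apply/setP => x; rewrite inE; apply: contra_eqT eqT => xT.
have [y xy] := isoG x; rewrite neq_ltn; apply/orP; left.
rewrite /vol (bigD1 x) //= [in X in _ < X](bigD1 x) //= -addSn leq_add //.
  rewrite (_ : deg (rel_in _ _) x = 0); first by rewrite card_gt0; apply/set0Pn; exists y; rewrite inE.
  apply/eqP; rewrite cards_eq0; apply/eqP/setP => z.
  by rewrite !inE /rel_in (negPf xT) andbF.
by apply: leq_sum => z _; apply: deg_rel_in.
Qed.

(** With [n (n - 1)] arcs on [n] vertices, [card_missing] leaves no missing pair. *)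
Lemma isomorphic_complete (G : sgraph) (n : nat) :
  vol (@adj G) = n * n.-1 -> #|G| = n -> isomorphic G (complete n).
Proof.
move=> volG cG; have adjG (x y : G) : adj x y = (x != y).
  apply/idP/idP => [xy|xy]; first by apply: contraTneq xy => ->; rewrite adj_irrefl.
  have := card_missing [set: G].
  have -> : vol (rel_in (@adj G) setT) = vol (@adj G).
    by apply: eq_bigr => z _; apply: eq_card => t; rewrite !inE /rel_in !inE !andbT.
  rewrite cardsT cG volG -[RHS]addn0 => /addnI/eqP; rewrite cards_eq0 => /eqP/setP/(_ (x, y)).
  by rewrite !inE /= xy /= => /negbFE.
exists (fun x : G => cast_ord cG (enum_rank x)); last first.
  move=> x y; rewrite adjG /= /complete_adj.
  by rewrite (inj_eq (@cast_ord_inj _ _ _)) (inj_eq enum_rank_inj).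
by apply: bij_comp (enum_rank_bij G); exists (cast_ord (esym cG)); [apply: cast_ordK | apply: cast_ordKV].
Qed.

Lemma hall_unique_maximizer (H : sgraph) : no_isolated H -> hall H -> ~ matching H ->
  exists n0, forall n, n0 < n -> unique_maximizer H 'C(n, 2) (complete n).
Proof.
move=> isoH hallH nmatH; have [p p_inj p_adj] := hall_perm hallH.
(* If no vertex has a neighbour other than its image under [p], neighbours are unique and [H] is a
   matching. *)
have [/existsP[a /existsP[b /andP[ab bpa]]]|/existsPn np] :=
  boolP [exists a, exists b : H, adj a b && (b != p a)]; last first.
  case: nmatH; apply: nbr_uniq_matching => // x.
  have nx y : adj x y -> y = p x.
    by move=> xy; move/existsPn: (np x) => /(_ y); rewrite xy /= negbK => /eqP.
  by move=> y z /nx-> /nx->.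
exists (16 * #|H| ^ 4 * (48 * #|H| ^ 4) ^ 2) => n n_gt.
have v0 : 0 < #|H| by apply/card_gt0P; exists a.
have n1 : 1 < n by apply: leq_trans n_gt; rewrite ltnS !(muln_gt0, expn_gt0) v0.
(* The isomorphism serves uniqueness, the number of vertices serves maximality. *)
have large (G : sgraph) : has_size 'C(n, 2) G -> n ^_ #|H| <= #|Emb H G| ->
    #|G| = n /\ isomorphic G (complete n).
  move=> Gm leG; have [volT cT] := extremal_core isoH p_inj p_adj ab bpa n_gt Gm leG.
  have cG : #|G| = n by rewrite -cT (vol_rel_in_eq Gm.1 volT) cardsT.
  by split=> //; apply: isomorphic_complete => //; apply/edges_vol/Gm.2.
split; last first.
  move=> G [Gm maxG]; apply: (large G Gm _).2.
  by rewrite -card_Emb_complete; apply/maxG/complete_size.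
split=> [|G Gm]; first exact: complete_size.
(* A graph beating [K_n] would have [n] vertices by [large], hence at most [n ^_ #|H|] injections
   from [H]. *)
rewrite card_Emb_complete leqNgt; apply/negP => lt.
have [cG _] := large G Gm (ltnW lt).
move: lt; rewrite -cG -card_inj_ffuns ltnNge => /negP; apply.
by apply/subset_leq_card/subsetP => f; rewrite !inE => /andP[].
Qed.

Theorem theorem1p2 (R : realType) (H : sgraph) (hH : no_isolated H) :
  (exists n0 : nat, forall n : nat, (n0 < n)%N ->
     unique_maximizer H 'C(n, 2) (complete n))
  <->
  (frac_independence_number_is H (#|H|%:R / 2%:R : R)%R /\ ~ matching H).
Proof.
split=> [[n0 maxK]|[/frac_independence_hall hallH]]; last exact: hall_unique_maximizer.
split; first exact/hall_frac_independence/(unique_maximizer_hall hH maxK).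
apply: (@unique_maximizer_not_matching _ (n0 + 3)) => //; first by lia.
by apply: maxK; lia.
Qed.
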